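(* The points of differentiability of the function $A:[0,\infty)\to\mathbb{R}$ are exactly the positive irrational numbers $\lambda$ for which the series $$\sum_{k\ge 0}(-1)^k\frac{\log q_{k+1}}{q_k}$$ converges, where $(q_k)_{k\ge 0}$ are the denominators of the convergents of the continued fraction of $\lambda$.
   Context: $\{t\}=t-\lfloor t\rfloor$ denotes the fractional part of the real number $t$. For $\lambda\ge 0$, $$A(\lambda)=\int_0^\infty \{t\}\{\lambda t\}\frac{dt}{t^2}.$$ For an irrational $\lambda>0$ with regular continued fraction expansion $[a_0;a_1,a_2,\dots]$, the convergents are $p_k/q_k=[a_0;a_1,\dots,a_k]$ in lowest terms with $q_k>0$ (so $q_0=1$). Convergence of the series means convergence of its sequence of partial sums to a finite limit. At $\lambda=0$ differentiability means differentiability from the right. *)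

(* Defs.v *)
From HB Require Import structures.
From mathcomp Require Import all_boot all_order all_algebra.
From mathcomp Require Import all_classical all_reals all_analysis.

Set Implicit Arguments.
Unset Strict Implicit.
Unset Printing Implicit Defensive.

Import Order.TTheory GRing.Theory Num.Theory.
Import numFieldTopology.Exports numFieldNormedType.Exports.

Local Open Scope classical_set_scope.
Local Open Scope ring_scope.

Definition fracpart (R : realType) (t : R) : R := t - (Num.floor t)%:~R.

(* Only the values for lambda >= 0 are meaningful: for lambda < 0 the
   integrand is not integrable near 0. *)
Definition autocorr (R : realType) (lambda : R) : R :=
  \int[@lebesgue_measure R]_(t in `]0, +oo[)
    (fracpart t * fracpart (lambda * t) / t ^+ 2).

(* Differentiability at x of a function considered on [0, +oo) only. *)
Definition differentiable_on_halfline (R : realType) (f : R -> R) (x : R)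
    : Prop :=
  (0 < x /\ derivable f x 1) \/
  (x = 0 /\ cvg ((f h - f 0) / h @[h --> 0^'+])).

(* x_0 = x, x_{k+1} = 1 / {x_k}; for irrational x no division by 0 occurs. *)
Fixpoint complete_quotient (R : realType) (x : R) (k : nat) : R :=
  if k is k'.+1 then (fracpart (complete_quotient x k'))^-1 else x.

Definition partial_quotient (R : realType) (x : R) (k : nat) : int :=
  Num.floor (complete_quotient x k).

(* [a 0; a 1, ..., a k]. *)
Fixpoint cfrac (a : nat -> int) (k : nat) : rat :=
  if k is k'.+1 then (a 0%N)%:~R + (cfrac (fun i => a i.+1) k')^-1
  else (a 0%N)%:~R.

Definition convergent (R : realType) (x : R) (k : nat) : rat :=
  cfrac (partial_quotient x) k.

(* denq is the positive denominator in lowest terms. *)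
Definition convergent_den (R : realType) (x : R) (k : nat) : int :=
  denq (convergent x k).

(* Main.v *)
Require Import Defs.
From HB Require Import structures.
From mathcomp Require Import all_boot all_order all_algebra.
From mathcomp Require Import all_classical all_reals all_analysis.
From mathcomp Require Import measurable_realfun.
From mathcomp Require Import ring lra zify.

Import Order.TTheory GRing.Theory Num.Theory.
Import numFieldTopology.Exports numFieldNormedType.Exports.

Local Open Scope classical_set_scope.
Local Open Scope ring_scope.

(** Write [{t}] for the fractional part, [bern y = ({y}^2 - {y}) / 2], and let
    [bsum x] be the sum of [bern (n x) / n^2] over [n >= 1], a continuous
    function of period [1].

    On a strip where one of the two factors of [{mu s} {nu s} / s^2] is affine,
    the integrand has an explicit antiderivative built from the integrals of
    [{y} / y] and [{y} / y^2].  Summing over the strips by parts leaves a sum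
    that is [bsum (nu / mu)] up to a factor, plus continuously differentiable
    functions ([corr_int_formula]).  Hence [autocorr x = bsum x / x + H x] with
    [H] continuously differentiable on the positive half-line, so that
    [autocorr] and [bsum] are differentiable at the same positive points
    ([derivable_autocorr]).  Exchanging [mu] and [nu] gives
    [autocorr x = x * autocorr (1 / x)], hence the reciprocity formula
    [bsum x = x^3 * bsum (1 / x) + G x] ([bsum_reciprocal]) in which
    [G' x = ln x / 2 + r x], with [r] continuous, and bounded near [0]
    ([der_recip_gap], [recip_rest_bound]).

    At [0] the difference quotient of [autocorr] is [autocorr (1 / h)], which
    tends to infinity with [1 / h].  At a positive rational the corners of
    [bern] make the second difference of [bsum] of order [h log (1 / h)]
    ([bsum_not_derivable_rational]).

    At an irrational [x], periodicity and reciprocity are iterated along the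
    continued fraction.  With the affine functions [e_j t = |q_(j-1) t - p_(j-1)|]
    (signs chosen so that they are positive at [x]) this gives
    [bsum t = sum_(j < K) (e_j t)^3 G (e_(j+1) t / e_j t)
    + (e_K t)^3 bsum (e_(K+1) t / e_K t)] for [t] close to [x]
    ([bsum_expand]).  The weight [3] is such that the derivative of the [j]-th
    term at [x] is [(-1)^j e_j x ln (e_(j+1) x / e_j x) / 2 + O(e_j x)], and its
    oscillation over the range of [t] that keeps [e_j] and [e_(j+1)] comparable
    to their values at [x] is [O(e_j x)], which is summable
    ([recip_dterm_lip]).  By dominated convergence the difference quotient of
    [bsum] at step [h] is the [K]-th partial sum of these derivatives, up to
    [o(1)] and up to the contribution of the remainder, estimated through the
    modulus of continuity [d log (1 / d)] of [bsum] ([bsum_quotient]).  For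
    steps adapted to [K] the remainder is negligible, whence necessity
    ([derivable_bsum_cvg]); for any step and the largest admissible [K] it is of
    the size of a term of the series, whence sufficiency
    ([cvg_derivable_bsum]).  Finally [e_j x] is so close to [1 / q_j] that the
    series of the derivatives converges exactly when the series of
    [(-1)^j log q_(j+1) / q_j] does ([cvg_recip_dterm_series]). *)

(** * Epsilon-delta forms of limits and derivatives *)

Section Elementary.
Context {R : realType}.
Implicit Types (f g df : R -> R) (x y a b d l e : R).

Lemma cvgn_epsP (u : nat -> R) l : u @ \oo --> l <->
  forall e, 0 < e -> exists N, forall n, (N <= n)%N -> `|u n - l| <= e.
Proof.
split.
  move=> /cvgrPdist_le H e e0; have [N _ HN] := H e e0.
  by exists N => n Nn; rewrite distrC; exact: HN.
move=> H; apply/cvgrPdist_le => e e0; have [N HN] := H e e0.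
by exists N => // n /= Nn; rewrite distrC; exact: HN.
Qed.

Lemma cvgn_le_bound (u : nat -> R) l (c : R) N0 : u @ \oo --> l ->
  (forall n, (N0 <= n)%N -> u n <= c) -> l <= c.
Proof.
move=> ul H; apply/ler_addgt0Pr => e e0.
have [N HN] := (cvgn_epsP _ _).1 ul e e0.
have := HN _ (leq_maxl N N0); have := H _ (leq_maxr N N0).
rewrite ler_norml => ? /andP[]; lra.
Qed.

Lemma continuous_epsP f x : {for x, continuous f} <->
  forall e, 0 < e -> exists2 dl, 0 < dl &
    forall y, `|y - x| < dl -> `|f y - f x| <= e.
Proof.
split.
  move=> /cvgrPdist_le H e e0; have := H e e0.
  move=> /nbhs_ballP[dl /= dl0 Hd]; exists dl => // y yx.
  by rewrite distrC; apply: Hd; rewrite /ball/= distrC.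
move=> H; apply/cvgrPdist_le => e e0; have [dl dl0 Hd] := H e e0.
apply/nbhs_ballP; exists dl => //= y yx; rewrite distrC; apply: Hd.
by rewrite distrC.
Qed.

Lemma is_derive_epsP f x d : is_derive x 1 f d <->
  forall e, 0 < e -> exists2 dl, 0 < dl &
    forall h, `|h| < dl -> `|f (x + h) - f x - d * h| <= e * `|h|.
Proof.
have E h : (h^-1 *: (f (h *: (1:R) + x) - f x) : R) = h^-1 * (f (x + h) - f x).
  by rewrite /GRing.scale /= mulr1 [x + h]addrC.
split.
  move=> [Df Dv] e e0; have Hc : (h^-1 *: (f (h *: (1:R) + x) - f x)) @[h --> 0^'] --> d.
    by rewrite -Dv; exact: Df.
  have /cvgrPdist_le/(_ e e0) := Hc.
  move=> /nbhs_ballP[dl /= dl0 Hd]; exists dl => // h hdl.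
  have [->|h0] := eqVneq h 0; first by rewrite mulr0 normr0 mulr0 addr0 !subrr normr0.
  have := Hd h; rewrite /ball/= sub0r normrN => /(_ hdl h0); rewrite E => He.
  have -> : f (x + h) - f x - d * h = - ((d - h^-1 * (f (x + h) - f x)) * h).
    by field.
  by rewrite normrN normrM ler_wpM2r.
move=> H.
have Hc : (h^-1 *: (f (h *: (1:R) + x) - f x)) @[h --> 0^'] --> d.
  apply/cvgrPdist_le => e e0; have [dl dl0 Hd] := H e e0.
  apply/nbhs_ballP; exists dl => //= h; rewrite /ball/= sub0r normrN => hdl h0.
  rewrite E; have := Hd h hdl.
  have -> : f (x + h) - f x - d * h = - ((d - h^-1 * (f (x + h) - f x)) * h).
    by field.
  by rewrite normrN normrM ler_pM2r // normr_gt0.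
apply: DeriveDef; first by apply/cvg_ex; exists d.
exact/cvg_lim.
Qed.

Lemma derivableE f x : derivable f x 1 <-> exists d, is_derive x 1 f d.
Proof.
by split=> [D|[d []]//]; exists ('D_1 f x); apply: DeriveDef.
Qed.

Lemma is_derive_near f g x d (dl : R) : 0 < dl ->
  (forall y, `|y - x| < dl -> f y = g y) -> is_derive x 1 f d -> is_derive x 1 g d.
Proof.
move=> dl0 fg /is_derive_epsP H; apply/is_derive_epsP => e e0.
have [r r0 Hr] := H e e0; exists (Num.min r dl); first by rewrite lt_min r0.
move=> h; rewrite lt_min => /andP[hr hd].
rewrite -!fg ?subrr ?normr0 ?Hr //.
by rewrite addrC addKr.
Qed.

Lemma is_derive_continuous f x d : is_derive x 1 f d -> {for x, continuous f}.
Proof. by move=> [H _]; apply/differentiable_continuous/derivable1_diffP. Qed.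

(** The rules below are pointwise, so that the derivative of an explicit formula
    can be assembled as a term following the formula. *)
Lemma derC x d : is_derive x 1 (fun _ => d) 0.
Proof. exact: is_derive_cst. Qed.

Lemma der_id x : is_derive x 1 (fun y => y) 1.
Proof. exact: is_derive_id. Qed.

Lemma derD f g x a b : is_derive x 1 f a -> is_derive x 1 g b ->
  is_derive x 1 (fun y => f y + g y) (a + b).
Proof. exact: is_deriveD. Qed.

Lemma derN f x a : is_derive x 1 f a -> is_derive x 1 (fun y => - f y) (- a).
Proof. exact: is_deriveN. Qed.

Lemma derB f g x a b : is_derive x 1 f a -> is_derive x 1 g b ->
  is_derive x 1 (fun y => f y - g y) (a - b).
Proof. by move=> df dg; apply: derD => //; apply: derN. Qed.

Lemma derM f g x a b : is_derive x 1 f a -> is_derive x 1 g b ->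
  is_derive x 1 (fun y => f y * g y) (a * g x + f x * b).
Proof.
move=> df dg; apply: (is_derive_eq (is_deriveM df dg)).
by rewrite /GRing.scale /= addrC [g x * a]mulrC.
Qed.

Lemma derZ f x a d : is_derive x 1 f a ->
  is_derive x 1 (fun y => d * f y) (d * a).
Proof.
by move=> df; apply: (is_derive_eq (derM _ _ _ _ _ (derC x d) df)); rewrite mul0r add0r.
Qed.

Lemma derV f x a : f x != 0 -> is_derive x 1 f a ->
  is_derive x 1 (fun y => (f y)^-1) (- a / f x ^+ 2).
Proof.
move=> fx df; apply: (is_derive_eq (is_deriveV fx df)).
by rewrite /GRing.scale /= mulNr mulrC mulNr.
Qed.

Lemma derX f x a (n : nat) : is_derive x 1 f a ->
  is_derive x 1 (fun y => f y ^+ n) (n%:R * f x ^+ n.-1 * a).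
Proof.
move=> df; elim: n => [|[|n] IH].
- by rewrite !mul0r; exact: derC.
- apply: (@is_derive_near f _ _ _ 1 ltr01); first by move=> y _; rewrite expr1.
  by apply: (is_derive_eq df); rewrite expr0 !mul1r.
- apply: (@is_derive_near (fun y => f y * f y ^+ n.+1) _ _ _ 1 ltr01).
    by move=> y _; rewrite -exprS.
  apply: (is_derive_eq (derM _ _ _ _ _ df IH)).
  by rewrite /= -[n.+2%:R]natr1 [f x ^+ n.+1]exprS; ring.
Qed.

Lemma der_comp f g x a b : is_derive (g x) 1 f a -> is_derive x 1 g b ->
  is_derive x 1 (fun y => f (g y)) (a * b).
Proof. exact: is_derive1_comp. Qed.

Lemma der_ln x : 0 < x -> is_derive x 1 (fun y => ln y) x^-1.
Proof. exact: is_derive1_ln. Qed.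

Lemma mvt_between f df a b :
  (forall c, a <= c <= b \/ b <= c <= a -> is_derive c 1 f (df c)) ->
  exists c, (a <= c <= b \/ b <= c <= a) /\ f b - f a = df c * (b - a).
Proof.
move=> H; wlog ab : a b H / a <= b.
  move=> W; have [ab|ba] := leP a b; first exact: W.
  have [c hc|c [hc E]] := W b a _ (ltW ba).
    by apply: H; case: hc; [right|left].
  by exists c; split; [case: hc; [right|left] | rewrite -opprB E; ring].
have [||c] := @MVT_segment R f df a b ab.
- move=> c; rewrite in_itv /= => /andP[ac cb]; apply: H; left.
  by rewrite !ltW.
- apply: derivable_within_continuous => c; rewrite in_itv /= => acb.
  by have [] := H c (or_introl acb).
rewrite in_itv /= => acb ->; exists c; split => //; by left.
Qed.

End Elementary.
Arguments derC {R}.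
Arguments der_id {R}.
Arguments derD {R f g x a b}.
Arguments derN {R f x a}.
Arguments derB {R f g x a b}.
Arguments derM {R f g x a b}.
Arguments derZ {R f x a}.
Arguments derV {R f x a}.
Arguments derX {R f x a}.
Arguments der_comp {R f g x a b}.
Arguments der_ln {R x}.

(** * The periodic Bernoulli function and the series it generates *)

Section Bernoulli.
Context {R : realType}.
Implicit Types (x y z a b d l e : R) (n m : int).

Lemma fracpart_ge0 x : 0 <= fracpart x.
Proof. by rewrite subr_ge0 floor_le. Qed.

Lemma fracpart_lt1 x : fracpart x < 1.
Proof. by have := floorD1_gt x; rewrite intrD /fracpart; lra. Qed.

Lemma fracpartD_int x n : fracpart (x + n%:~R) = fracpart x.
Proof.
rewrite /fracpart floorDrz ?intr_int// intrKfloor intrD; ring.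
Qed.

Lemma floor_cell x n : n%:~R <= x < n%:~R + 1 -> fracpart x = x - n%:~R.
Proof.
by move=> xn; rewrite /fracpart (@floor_def _ x n) // intrD.
Qed.

Definition bern y : R := (fracpart y ^+ 2 - fracpart y) / 2.

Lemma bernD_int x n : bern (x + n%:~R) = bern x.
Proof. by rewrite /bern fracpartD_int. Qed.

Lemma bern_cell n y : n%:~R <= y <= n%:~R + 1 ->
  bern y = (y - n%:~R) * (y - n%:~R - 1) / 2.
Proof.
move=> /andP[ny]; rewrite le_eqVlt => /predU1P[->|yn].
  rewrite /bern (@floor_cell _ (n + 1)).
    by rewrite intrD; ring.
  by rewrite intrD; lra.
by rewrite /bern (@floor_cell _ n) ?ny //; field.
Qed.

Lemma bern_le0 y : bern y <= 0.
Proof.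
rewrite /bern; have := fracpart_ge0 y; have := fracpart_lt1 y; nra.
Qed.

Lemma bern_ge y : - 8^-1 <= bern y.
Proof.
rewrite /bern; have : 0 <= (fracpart y - 2^-1) ^+ 2 by exact: sqr_ge0.
nra.
Qed.

Lemma bern_norm y : `|bern y| <= 8^-1.
Proof. by rewrite ler_norml bern_ge (le_trans (bern_le0 y)). Qed.

(** Two of these parabolas differ by an affine function, and on each unit cell
    the lowest one is the one that defines [bern].  The semi-concavity that
    results ([bern_slope]) dispenses with discussing the corners of [bern]. *)
Lemma bern_le_parabola z n : bern z <= (z - n%:~R) * (z - n%:~R - 1) / 2.
Proof.
have -> : z = fracpart z + (Num.floor z)%:~R by rewrite /fracpart subrK.
rewrite bernD_int (@bern_cell 0); last first.
  by have := fracpart_ge0 z; have := fracpart_lt1 z; lra.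
have w0 := fracpart_ge0 z; have w1 := fracpart_lt1 z.
set w := fracpart z in w0 w1 *.
have -> : w + (Num.floor z)%:~R - n%:~R = w + (Num.floor z - n)%:~R.
  by rewrite intrB; ring.
set k := Num.floor z - n.
have : 0 <= (k%:~R : R) * (k%:~R - 1 + 2 * w).
  case: (ltrgtP k 0) => [k0|k0|->]; last by rewrite mul0r.
  - have : (k%:~R : R) <= -1 by rewrite -[-1]/((-1)%:~R) ler_int; lia.
    nra.
  - have : (1 : R) <= k%:~R by rewrite -[1]/((1)%:~R) ler_int; lia.
    nra.
nra.
Qed.

Lemma bern_slope y : exists s : R, `|s| <= 2^-1 /\
  forall z, bern z <= bern y + s * (z - y) + (z - y) ^+ 2 / 2.
Proof.
exists (fracpart y - 2^-1); split.
  have := fracpart_ge0 y; have := fracpart_lt1 y.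
  by rewrite ler_norml => *; apply/andP; split; lra.
move=> z; have := bern_le_parabola z (Num.floor y).
suff -> : bern y = (y - (Num.floor y)%:~R) * (y - (Num.floor y)%:~R - 1) / 2.
  rewrite /fracpart; nra.
by apply: bern_cell; have := floor_itv y; rewrite intrD => /andP[-> /ltW].
Qed.

Lemma bern_lip y z : `|bern z - bern y| <= `|z - y|.
Proof.
wlog: y z / bern y <= bern z.
  move=> W; have [|/ltW] := leP (bern y) (bern z); first exact: W.
  by move=> /W; rewrite distrC [X in _ <= X]distrC.
move=> yz; rewrite ger0_norm ?subr_ge0 //.
have [s1|s1] := leP 1 `|z - y|.
  have := bern_ge y; have := bern_le0 z.
  lra.
have [s [hs /(_ z)]] := bern_slope y.
have : s * (z - y) <= 2^-1 * `|z - y|.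
  by rewrite (le_trans (ler_norm _)) // normrM ler_wpM2r.
have : (z - y) ^+ 2 <= `|z - y|.
  by rewrite -real_normK ?num_real // expr2 ler_piMl // ltW.
lra.
Qed.

Lemma bernN y : bern (- y) = bern y.
Proof.
rewrite (@bern_cell (Num.floor y) y); last first.
  by have := floor_itv y; rewrite intrD => /andP[-> /ltW].
rewrite (@bern_cell (- Num.floor y - 1) (- y)).
  by rewrite intrB mulrNz; field.
by have := floor_itv y; rewrite intrB intrD mulrNz => /andP[? ?]; apply/andP; split; lra.
Qed.

Lemma continuous_bern : continuous bern.
Proof.
move=> x; apply/continuous_epsP => e e0; exists e => // y /ltW yx.
exact: le_trans (bern_lip _ _) yx.
Qed.

Lemma is_derive_bern n y : n%:~R < y < n%:~R + 1 ->
  is_derive y 1 bern (y - n%:~R - 2^-1).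
Proof.
move=> /andP[ny yn].
pose g z : R := (z - n%:~R) * (z - n%:~R - 1) / 2.
apply: (@is_derive_near _ g bern y _ (Num.min (y - n%:~R) (n%:~R + 1 - y))).
- by rewrite lt_min; apply/andP; split; lra.
- move=> z; rewrite lt_min !ltr_norml => /andP[/andP[? ?] /andP[? ?]].
  by rewrite (@bern_cell n) //; apply/andP; split; lra.
- apply/is_derive_epsP => e e0; exists e => // h he.
  have -> : g (y + h) - g y - (y - n%:~R - 2^-1) * h = h * (h / 2).
    by rewrite /g; field.
  rewrite !normrM (gtr0_norm (_ : 0 < 2^-1)) ?invr_gt0 //.
  have := normr_ge0 h; nra.
Qed.

End Bernoulli.

Section Tails.
Context {R : realType}.

(** The Cauchy criterion with an explicit modulus also bounds the error. *)
Lemma cauchy_rate (u e : nat -> R) : e @ \oo --> 0 ->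
  (forall m n, (0 < m)%N -> (m <= n)%N -> `|u n - u m| <= e m) ->
  exists l, u @ \oo --> l /\ forall m, (0 < m)%N -> `|l - u m| <= e m.
Proof.
move=> e0 H.
have cu : cvgn u.
  apply: cauchy_cvg; apply/cauchyP => r r0.
  have [N HN] := (cvgn_epsP _ _).1 e0 (r / 2) (divr_gt0 r0 (ltr0Sn _ 1)).
  exists (u N.+1); rewrite -/(nbhs _); exists N.+1 => // n /= Nn.
  rewrite /ball /= distrC; apply: le_lt_trans (H _ _ _ Nn) _ => //.
  have := HN N.+1 (leqnSn N); rewrite subr0 => /(le_trans (ler_norm _)).
  lra.
exists (limn u); split => // m m0.
have : (fun n => `|u n - u m|) @ \oo --> `|limn u - u m|.
  by apply: cvg_norm; apply: cvgB => //; exact: cvg_cst.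
move=> h; rewrite -(cvg_lim _ h) //.
apply: limr_le; first by apply/cvg_ex; exists `|limn u - u m|.
by exists m => // n /= mn; exact: H.
Qed.

Lemma cvg_cst_div (c : R) : (fun n => c / n%:R) @ \oo --> 0.
Proof.
apply/cvgn_epsP => e e0; exists (Num.bound (`|c| / e)).+1 => n Nn.
have n0 : (0 : R) < n%:R by rewrite ltr0n; apply: leq_trans Nn.
rewrite subr0 normrM normfV (gtr0_norm n0) ler_pdivrMr // mulrC -ler_pdivrMr //.
have hb : `|c| / e < (Num.bound (`|c| / e))%:R.
  by apply: archi_boundP; rewrite divr_ge0 // ltW.
apply: (le_trans (ltW hb)).
by rewrite ler_nat; exact: leq_trans Nn.
Qed.

(** Each term is compared with [c / n - c / (n + 1)], hence the tail bound. *)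
Lemma square_tail (u : nat -> R) (c : R) :
  (forall n, `|u n| <= c / n.+1%:R ^+ 2) ->
  exists l, series u @ \oo --> l /\
    forall m, (0 < m)%N -> `|l - series u m| <= c / m%:R.
Proof.
move=> H.
have c0 : 0 <= c by have := H 0%N; rewrite expr1n divr1; exact: le_trans.
apply: cauchy_rate; first exact: cvg_cst_div.
move=> m n m0 mn; rewrite /series /=.
have K : `|\sum_(m <= i < n) u i| <= c / m%:R - c / n%:R.
  apply: le_trans (ler_norm_sum _ _ _) _.
  have -> : c / m%:R - c / n%:R = \sum_(m <= i < n) (c / i%:R - c / i.+1%:R).
    rewrite -opprB -(telescope_sumr (fun i => c / i%:R)) // -sumrN.
    by apply: eq_bigr => i _; rewrite opprB.
  rewrite !big_nat; apply: ler_sum => i /andP[mi _].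
  have i0 : (0 : R) < i%:R by rewrite ltr0n (leq_trans m0).
  apply: le_trans (H i) _; rewrite -mulrBr ler_wpM2l //.
  have -> : i%:R^-1 - i.+1%:R^-1 = (i%:R * i.+1%:R)^-1 :> R.
    rewrite -natr1; field; lra.
  rewrite lef_pV2 ?posrE ?exprn_gt0 ?mulr_gt0 //.
  by rewrite expr2 ler_pM2r // ler_nat.
have -> : \sum_(0 <= k < n) u k - \sum_(0 <= k < m) u k = \sum_(m <= i < n) u i.
  by rewrite (@big_cat_nat _ _ _ m) //= addrAC subrr add0r.
apply: le_trans K _; rewrite lerBlDr lerDl divr_ge0 //.
Qed.

End Tails.

Section BernoulliSeries.
Context {R : realType}.
Implicit Types (x y z a b d l e h : R) (n m : int).

Definition bpart x (N : nat) : R :=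
  series (fun n : nat => bern (n.+1%:R * x) / n.+1%:R ^+ 2) N.

Definition bsum x : R := limn (bpart x).

Lemma bsum_cvg_err x : bpart x @ \oo --> bsum x /\
  forall N, (0 < N)%N -> `|bsum x - bpart x N| <= 8^-1 / N%:R.
Proof.
have [|l [cl hl]] := @square_tail R
    (fun n : nat => bern (n.+1%:R * x) / n.+1%:R ^+ 2) 8^-1.
  move=> n; rewrite normrM normfV (@gtr0_norm _ (_ ^+ 2)) ?exprn_gt0 //.
  by rewrite ler_pM2r ?invr_gt0 ?exprn_gt0 ?bern_norm.
have E : bsum x = l by exact: cvg_lim cl.
by rewrite E.
Qed.

Lemma bpart_cvg x : bpart x @ \oo --> bsum x.
Proof. by have [] := bsum_cvg_err x. Qed.

Lemma bsum_err x N : (0 < N)%N -> `|bsum x - bpart x N| <= 8^-1 / N%:R.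
Proof. by have [_] := bsum_cvg_err x; apply. Qed.

Lemma bsumD_int x n : bsum (x + n%:~R) = bsum x.
Proof.
congr (limn _); apply/funext => N; apply: eq_bigr => i _; congr (_ / _).
rewrite mulrDr (_ : i.+1%:R * n%:~R = ((i.+1 : int) * n)%:~R) ?bernD_int //.
by rewrite intrM.
Qed.

Lemma bsum_norm x : `|bsum x| <= 1.
Proof.
have := @bsum_err x 1 isT; rewrite /bpart /series /= big_nat1 expr1n !divr1 mul1r.
have := bern_norm x; rewrite !ler_norml => /andP[? ?] /andP[? ?]; apply/andP; split; lra.
Qed.

Lemma harmonic_le_ln N : (0 < N)%N ->
  \sum_(0 <= i < N) i.+1%:R^-1 <= 1 + ln (N%:R : R).
Proof.
elim: N => // -[_ _|N IH _]; first by rewrite big_nat1 invr1 ln1 addr0.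
rewrite big_nat_recr //=; have {}IH := IH isT.
have n0 : (0 : R) < N.+1%:R by rewrite ltr0n.
have m0 : (0 : R) < N.+2%:R by rewrite ltr0n.
have : ln (1 + - N.+2%:R^-1 : R) <= - N.+2%:R^-1.
  by apply: le_ln1Dx; rewrite ltrN2 invf_lt1 // ltr1n.
have -> : 1 + - N.+2%:R^-1 = N.+1%:R / N.+2%:R :> R.
  by rewrite -[N.+2%:R]natr1; field; lra.
rewrite ln_div ?posrE //; move: IH; move: (\sum_(0 <= i < N.+1) _) => S; move: (ln _) (ln _) (N.+2%:R^-1) => u v w. lra.
Qed.

Lemma bpart_lip x y N :
  `|bpart x N - bpart y N| <= `|x - y| * \sum_(0 <= i < N) i.+1%:R^-1.
Proof.
rewrite /bpart /series /= -sumrB mulr_sumr.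
apply: le_trans (ler_norm_sum _ _ _) _; apply: ler_sum => i _.
have i0 : (0 : R) < i.+1%:R by rewrite ltr0n.
rewrite -mulrBl normrM normfV (@gtr0_norm _ (_ ^+ 2)) ?exprn_gt0 //.
rewrite ler_pdivrMr ?exprn_gt0 //.
have := bern_lip (i.+1%:R * y) (i.+1%:R * x).
rewrite -mulrBr normrM (gtr0_norm i0) => /le_trans; apply.
by rewrite expr2 mulrA mulfVK ?gt_eqF // mulrC.
Qed.

Lemma bsum_diff_le x y N : (0 < N)%N ->
  `|bsum x - bsum y| <= `|x - y| * \sum_(0 <= i < N) i.+1%:R^-1 + 4^-1 / N%:R.
Proof.
move=> N0; have -> : bsum x - bsum y =
  (bsum x - bpart x N) + (bpart x N - bpart y N) - (bsum y - bpart y N) by ring.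
have := bsum_err x _ N0; have := bsum_err y _ N0; have := bpart_lip x y N.
have -> : 4^-1 / N%:R = 8^-1 / N%:R + 8^-1 / N%:R :> R.
  by rewrite -mulrDl; congr (_ * _); lra.
have := ler_normB (bsum x - bpart x N + (bpart x N - bpart y N)) (bsum y - bpart y N).
have := ler_normD (bsum x - bpart x N) (bpart x N - bpart y N).
lra.
Qed.

Lemma ln2_le1 : ln (2 : R) <= 1.
Proof. by have := @le_ln1Dx R 1; lra. Qed.

(** Cutting the series at [n] close to [1 / |x - y|]: below the cut each term
    is Lipschitz, above it is bounded. *)
Lemma bsum_log_modulus x y k : 0 < k <= 1 -> k <= `|x - y| ->
  `|bsum x - bsum y| <= `|x - y| * (3 - ln k).
Proof.
move=> /andP[k0 k1] kd; set d := `|x - y| in kd *.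
have d0 : 0 < d by exact: lt_le_trans kd.
have lk : ln k <= 0 by exact: ln_le0.
have [d1|d1] := leP d 1; last first.
  have := ler_normB (bsum x) (bsum y); have := bsum_norm x; have := bsum_norm y; nra.
(* The cut, between [1 / d] and [1 / d + 1]. *)
set N := (Num.trunc d^-1).+1.
have /andP[N1 N2] : d^-1 < N%:R <= d^-1 + 1.
  have := truncn_itv (ltW (_ : 0 < d^-1)); rewrite invr_gt0 => /(_ d0) /andP[? ->] /=.
  by rewrite -natr1 lerD2r.
have Npos : (0 : R) < N%:R by rewrite ltr0n.
apply: le_trans (bsum_diff_le x y _ (ltn0Sn (Num.trunc d^-1))) _; rewrite -/N -/d.
have H := harmonic_le_ln _ (ltn0Sn (Num.trunc d^-1)); rewrite -/N in H.
have : ln (N%:R : R) <= 1 - ln k.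
  have dd : 1 <= d^-1 by rewrite invf_ge1.
  have : ln (N%:R : R) <= ln (2 * d^-1).
    by rewrite ler_ln ?posrE ?mulr_gt0 ?invr_gt0 //; lra.
  rewrite lnM ?posrE ?invr_gt0 // lnV ?posrE //.
  have : ln k <= ln d by rewrite ler_ln ?posrE.
  have := ln2_le1; lra.
have : 4^-1 / N%:R <= d.
  rewrite ler_pdivrMr //; have : 1 <= d * N%:R by rewrite -ler_pdivrMl // mulr1 ltW.
  lra.
nra.
Qed.

Lemma continuous_bsum : continuous bsum.
Proof.
move=> x; apply/continuous_epsP => e e0.
have [N HN] := (cvgn_epsP _ _).1 (@cvg_cst_div R 4^-1) (e / 2) (divr_gt0 e0 (ltr0Sn _ 1)).
pose H : R := \sum_(0 <= i < N.+1) i.+1%:R^-1.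
have H0 : 0 < H.
  by rewrite /H big_nat_recl //= ltr_pwDl ?invr_gt0 // sumr_ge0.
exists (e / 2 / H); first by rewrite !divr_gt0.
move=> y yx; apply: le_trans (bsum_diff_le _ _ _ (ltn0Sn N)) _.
have := HN N.+1 (leqnSn N); rewrite subr0 => /(le_trans (ler_norm _)).
move: yx; rewrite -/H ltr_pdivlMr //.
move: (_ / N.+1%:R) (_ * H) => u v; lra.
Qed.

Lemma bern_diff2_le y h : bern (y + h) + bern (y - h) - 2 * bern y <= h ^+ 2.
Proof.
have [s [_ H]] := bern_slope y.
have := H (y + h); have := H (y - h).
rewrite [y + h]addrC [y - h]addrC !addrK sqrrN; lra.
Qed.

Lemma bern_diff2_int n h : 0 <= h <= 2^-1 ->
  bern (n%:~R + h) + bern (n%:~R - h) - 2 * bern n%:~R <= - (h / 2).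
Proof.
move=> /andP[h0 h1]; rewrite ![n%:~R + _]addrC !bernD_int bernN.
have -> : bern (n%:~R : R) = bern 0 by rewrite -[n%:~R]add0r bernD_int.
rewrite (@bern_cell _ 0 h); last by apply/andP; split; lra.
rewrite (@bern_cell _ 0 0); last by apply/andP; split; lra.
nra.
Qed.

Lemma harmonic_unbounded (c : R) : exists N0, forall N, (N0 <= N)%N ->
  c < \sum_(0 <= i < N) i.+1%:R^-1.
Proof.
apply: contrapT => H; apply: (@dvg_harmonic R).
have nd : nondecreasing_seq (series (@harmonic R)).
  by apply/nondecreasing_seqP => n; rewrite /series /= big_nat_recr //= lerDl.
apply: nondecreasing_is_cvgn => //; exists c => _ [n _ <-].
rewrite leNgt; apply/negP => cn; apply: H; exists n => N nN.
exact: lt_le_trans cn (nd _ _ nN).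
Qed.

(** At [p/q] the terms whose index is a multiple of [q] sit at a corner of
    [bern]; they contribute a negative multiple of [h log (1/h)] to the second
    difference, while semi-concavity bounds all the others by [O(h)]. *)
Lemma bsum_not_derivable_rational (p : int) (q : nat) : (0 < q)%N ->
  ~ derivable bsum (p%:~R / q%:R) 1.
Proof.
move=> q0 /derivableE[d /is_derive_epsP/(_ 1 ltr01)[dl dl0 Hd]].
set x : R := p%:~R / q%:R in Hd.
have qR : (0 : R) < q%:R by rewrite ltr0n.
pose E (i : nat) : R := if (q %| i.+1)%N then i.+1%:R^-1 else 0.
have E0 i : 0 <= E i by rewrite /E; case: ifP.
have sumE K : (\sum_(0 <= i < K) i.+1%:R^-1) / q%:R <= \sum_(0 <= i < K * q) E i.
  elim: K => [|K IH]; first by rewrite mul0n !big_nil mul0r.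
  rewrite big_nat_recr //= mulrDl mulSn addnC [X in _ <= X](@big_cat_nat _ _ _ (K * q)) ?leq_addr //=.
  apply: lerD => //.
  have Eq : (K * q + q)%N = (K * q + q.-1).+1 by rewrite -addnS prednK.
  rewrite [X in \sum_(_ <= _ < X) _]Eq big_nat_recr ?leq_addr //=.
  rewrite -[X in X <= _]add0r; apply: lerD; first exact: sumr_ge0.
  by rewrite /E -Eq addnC -mulSn dvdn_mull // natrM invfM.
have [K0 HK0] := harmonic_unbounded (7 * q%:R).
have [K1 HK1] := (cvgn_epsP _ _).1 (@cvg_cst_div R 1) (dl / 2) (divr_gt0 dl0 (ltr0Sn _ 1)).
(* [N] is a multiple of [q], and [h = 1 / (2 N)] keeps [n h <= 1 / 2] for all
   [n <= N], the range in which the corner at a multiple of [q] is felt. *)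
pose K := (K0 + K1).+1; pose N := (K * q)%N.
have N0 : (0 < N)%N by rewrite muln_gt0.
have NR : (0 : R) < N%:R by rewrite ltr0n.
pose h : R := (2 * N%:R)^-1.
have h0 : 0 < h by rewrite invr_gt0 mulr_gt0.
have Nh : N%:R * h = 2^-1 by rewrite /h; field; lra.
have hdl : h < dl.
  have : 1 / N%:R <= dl / 2.
    apply: le_trans (ler_norm _) _; have := HK1 N; rewrite subr0; apply.
    by apply: leq_trans (leq_pmulr _ q0); rewrite /K; lia.
  have -> : 1 / N%:R = 2 * h by rewrite /h; field; lra.
  lra.
have sd : bpart (x + h) N + bpart (x - h) N - 2 * bpart x N <=
    h / 2 - h / 2 * \sum_(0 <= i < N) E i.
  have Eh : h / 2 = \sum_(0 <= i < N) h ^+ 2.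
    by rewrite sumr_const_nat subn0 -[RHS]mulr_natl [X in _ = _ * X]expr2 mulrA Nh mulrC.
  rewrite [X in _ <= X - _]Eh /bpart /series /= -big_split /= !mulr_sumr -!sumrB /=.
  rewrite big_nat [X in _ <= X]big_nat; apply: ler_sum => i /andP[_ iN].
  have i0 : (0 : R) < i.+1%:R by rewrite ltr0n.
  have i2 : (0 : R) < i.+1%:R ^+ 2 by exact: exprn_gt0.
  rewrite [2 * (_ / _)]mulrA -mulrDl -mulrBl ler_pdivrMr // mulrDr mulrBr.
  rewrite /E; case: ifP => [/dvdnP[k Ek]|_]; last first.
    rewrite mulr0 subr0 -exprMn.
    by have := bern_diff2_le (i.+1%:R * x) (i.+1%:R * h); rewrite [h * _]mulrC.
  have -> : i.+1%:R * x = ((k : int) * p)%:~R.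
    by rewrite Ek natrM /x intrM -!pmulrn; field; lra.
  have ih : 0 <= i.+1%:R * h <= 2^-1.
    apply/andP; split; first by rewrite mulr_ge0 // ltW.
    by rewrite -Nh; apply: ler_wpM2r; [exact: ltW|rewrite ler_nat].
  apply: le_trans (bern_diff2_int _ _ ih) _.
  have -> : (h ^+ 2 - h / 2 / i.+1%:R) * i.+1%:R ^+ 2 =
      (i.+1%:R * h) ^+ 2 - i.+1%:R * h / 2 by field; rewrite gt_eqF.
  by rewrite lerDr sqr_ge0.
have e1 := bsum_err (x + h) _ N0; have e2 := bsum_err (x - h) _ N0.
have e3 := bsum_err x _ N0.
have E8 : 8^-1 / N%:R = h / 4 by rewrite /h; field; lra.
rewrite E8 in e1 e2 e3.
have := Hd h; rewrite gtr0_norm // => /(_ hdl) d1.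
have := Hd (- h); rewrite normrN gtr0_norm // => /(_ hdl) d2.
have : 7 < \sum_(0 <= i < N) E i.
  apply: lt_le_trans (sumE K); rewrite ltr_pdivlMr //; apply: HK0.
  by rewrite /K; lia.
move: e1 e2 e3 d1 d2; rewrite !ler_norml => /andP[? ?] /andP[? ?] /andP[? ?] /andP[? ?] /andP[? ?].
move=> H7; have : h * 7 < h * \sum_(0 <= i < N) E i by rewrite ltr_pM2l.
lra.
Qed.

End BernoulliSeries.

(** * Antiderivatives of the fractional part over powers *)

Section Antiderivatives.
Context {R : realType}.
Implicit Types (x y z a b d l e h : R).

Lemma antiderivative_exists (f : R -> R) : continuous f ->
  exists F : R -> R, forall y, 0 < y -> is_derive y 1 F (f y).
Proof.
move=> cf.
pose F x := (\int[@lebesgue_measure R]_(t in `[-1, x]) f t)%R.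
exists F => y y0.
have [||||D E] := @continuous_FTC1_closed R f (-1) y (y + 1).
- by rewrite ltrDl.
- apply: continuous_compact_integrable; first exact: segment_compact.
  exact: continuous_subspaceT.
- lra.
- exact: cf.
by apply: DeriveDef; [exact: D|rewrite -derive1E; exact: E].
Qed.

Lemma decay_limit (F e : R -> R) : (fun n : nat => e n%:R) @ \oo --> 0 ->
  (forall y z, 0 < y -> y <= z -> `|F z - F y| <= e y) ->
  exists l, forall y, 0 < y -> `|F y - l| <= e y.
Proof.
move=> e0 H.
have [m n m0 mn|l [cl _]] := @cauchy_rate R (fun n => F n%:R) (fun n => e n%:R) e0.
  by apply: H; rewrite ?ltr0n // ler_nat.
exists l => y y0; apply/ler_addgt0Pr => r r0.
have [N HN] := (cvgn_epsP _ _).1 cl r r0.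
pose n := maxn N (Num.trunc y).+1.
have yn : y <= n%:R.
  have := truncn_itv (ltW y0) => /andP[_ /ltW yt]; apply: le_trans yt _.
  by rewrite ler_nat leq_maxr.
have h1 := HN n (leq_maxl _ _); have h2 := H _ _ y0 yn.
have -> : F y - l = (F n%:R - l) - (F n%:R - F y) by ring.
by have := ler_normB (F n%:R - l) (F n%:R - F y); lra.
Qed.

(** Both [G + F] and [G - F] are nonincreasing. *)
Lemma mvt_dominated (F G g dg : R -> R) y z : 0 < y -> y <= z ->
  (forall t : R, 0 < t -> is_derive t 1 F (g t)) ->
  (forall t : R, 0 < t -> is_derive t 1 G (dg t)) ->
  (forall t : R, 0 < t -> `|g t| <= - dg t) ->
  `|F z - F y| <= G y - G z.
Proof.
move=> y0 yz dF dG gdg.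
have P t : y <= t <= z \/ z <= t <= y -> 0 < t.
  by case=> /andP[h _]; apply: lt_le_trans h => //; apply: lt_le_trans yz.
have H (s : R) : `|s| = 1 -> s * (F z - F y) <= G y - G z.
  move=> s1.
  have D t : y <= t <= z \/ z <= t <= y ->
      is_derive t 1 (fun u => s * F u + G u) (s * g t + dg t).
    move=> /P t0; apply: is_deriveD; last exact: dG.
    by apply: is_deriveZ; exact: dF.
  have [c [hc E]] := mvt_between _ _ _ _ D.
  have c0 := P c hc; have := gdg c c0.
  have : s * g c <= `|g c| by rewrite (le_trans (ler_norm _)) // normrM s1 mul1r.
  have : 0 <= z - y by rewrite subr_ge0.
  move: E; set w := s * g c => E ? ? ?.
  have : (w + dg c) * (z - y) <= 0 by rewrite mulr_le0_ge0 //; lra.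
  rewrite -E; lra.
rewrite ler_norml; apply/andP; split.
  by have := H (-1); rewrite normrN normr1 => /(_ erefl); lra.
by have := H 1; rewrite normr1 => /(_ erefl); lra.
Qed.

Lemma max1_continuous (k : R -> R) : (forall y, 1 <= y -> {for y, continuous k}) ->
  continuous (fun y => k (Num.max y 1)).
Proof.
move=> ck y.
apply: (@continuous_comp _ _ _ (fun y => Num.max y 1) k).
  by apply: (@continuous_max _ _ (fun y : R => y) (fun _ : R => 1)); [exact: cvg_id|exact: cvg_cst].
by apply: ck; rewrite le_max lexx orbT.
Qed.

Lemma bern1 : bern (1 : R) = 0.
Proof. by rewrite (@bern_cell _ 1) /= ?subrr ?mul0r // lexx lerDl ler01. Qed.

(** [bern y / y ^+ k] may blow up at [0], so its polynomial expression on the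
    cell [[0, 1]] is split off; what is left vanishes there and extends to a
    continuous function on the whole line. *)
Lemma bern_antiderivative (k : nat) (p : R -> R) :
  (forall y, 0 < y -> is_derive y 1 p ((y ^+ 2 - y) / 2 / y ^+ k)) ->
  exists F : R -> R, forall y, 0 < y -> is_derive y 1 F (bern y / y ^+ k).
Proof.
move=> dp; pose g y := (bern y - (y ^+ 2 - y) / 2) / y ^+ k.
have cg : forall y, 1 <= y -> {for y, continuous g}.
  move=> y y1; have y0 : y != 0 by apply: lt0r_neq0; lra.
  apply: cvgM; last first.
    apply: cvgV; first by rewrite expf_neq0.
    by apply: (@exprn_continuous R).
  apply: cvgB; first exact: continuous_bern.
  apply: cvgM; last exact: cvg_cst.
  by apply: cvgB; [exact: exprn_continuous|exact: cvg_id].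
have [F0 dF0] := @antiderivative_exists _ (max1_continuous _ cg).
exists (p \+ F0) => y y0.
apply: (@is_derive_eq _ _ _ _ _ _ _ _ (is_deriveD (dp y y0) (dF0 y y0))).
rewrite /g; have [y1|y1] := leP y 1; last first.
    by field; rewrite expf_neq0 // lt0r_neq0.
rewrite bern1 (@bern_cell _ 0 y); last by apply/andP; split; lra.
by field; rewrite ?expr1n ?oner_eq0 expf_neq0 // lt0r_neq0.
Qed.

Lemma tail3_exists : exists tail3 : R -> R,
  (forall y, 0 < y -> is_derive y 1 tail3 (- (bern y / y ^+ 3))) /\
  (forall y, 0 < y -> `|tail3 y| <= 16^-1 / y ^+ 2).
Proof.
have [F dF] : exists F : R -> R, forall y, 0 < y -> is_derive y 1 F (bern y / y ^+ 3).
  apply: (@bern_antiderivative 3 (fun y => 2^-1 * (ln y + y^-1))) => y y0.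
  have yn := lt0r_neq0 y0.
  by apply: (is_derive_eq (derZ 2^-1 (derD (der_ln y0) (derV (f := fun z : R => z) yn (der_id y))))); field.
have dG y : 0 < y -> is_derive y 1 (fun y => 16^-1 / y ^+ 2) (- (8^-1 / y ^+ 3)).
  move=> y0; have yn := lt0r_neq0 y0.
  have y2 : y ^+ 2 != 0 by rewrite expf_neq0.
  by apply: (is_derive_eq (derZ 16^-1 (derV (f := fun z : R => z ^+ 2) y2 (derX 2 (der_id y))))); field.
have B y z : 0 < y -> y <= z -> `|F z - F y| <= 16^-1 / y ^+ 2.
  move=> y0 yz; have := @mvt_dominated F _ _ _ _ _ y0 yz dF dG.
  have P : forall t : R, 0 < t -> `|bern t / t ^+ 3| <= - - (8^-1 / t ^+ 3).
    move=> t t0; rewrite opprK normrM normfV (@gtr0_norm _ (t ^+ 3)) ?exprn_gt0 //.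
    by rewrite ler_pM2r ?invr_gt0 ?exprn_gt0 // bern_norm.
  move=> /(_ P) /le_trans; apply; rewrite lerBlDr lerDl.
  by rewrite divr_ge0 // ?sqr_ge0.
have c0 : (fun n : nat => 16^-1 / (n%:R : R) ^+ 2) @ \oo --> 0.
  apply/cvgn_epsP => e e0.
  have [N HN] := (cvgn_epsP _ _).1 (@cvg_cst_div R 16^-1) e e0.
  exists N.+1 => n Nn; apply: le_trans (HN n (ltnW Nn)); rewrite !subr0.
  have n1 : (1 : R) <= n%:R by rewrite ler1n (leq_trans _ Nn).
  have n0 : (0 : R) < n%:R by lra.
  rewrite !normrM !normfV ler_wpM2l // normrX !(ger0_norm (ltW n0)).
  by rewrite lef_pV2 ?posrE ?exprn_gt0 // expr2 ler_peMr // ltW.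
have [l hl] := decay_limit F _ c0 B.
exists (fun y => l - F y); split => y y0; last by rewrite distrC hl.
by apply: (is_derive_eq (derB (derC y l) (dF y y0))); rewrite sub0r.
Qed.

Lemma prim2_exists : exists (prim2 : R -> R) (l : R),
  [/\ forall y, 0 < y -> is_derive y 1 prim2 (bern y / y ^+ 2),
      prim2 1 = 1 & forall y, 0 < y -> `|prim2 y - l| <= 8^-1 / y].
Proof.
have [F dF] : exists F : R -> R, forall y, 0 < y -> is_derive y 1 F (bern y / y ^+ 2).
  apply: (@bern_antiderivative 2 (fun y => 2^-1 * (y - ln y))) => y y0.
  have yn := lt0r_neq0 y0.
  by apply: (is_derive_eq (derZ 2^-1 (derB (der_id y) (der_ln y0)))); field.
have dG y : 0 < y -> is_derive y 1 (fun y => 8^-1 / y) (- (8^-1 / y ^+ 2)).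
  move=> y0; have yn := lt0r_neq0 y0.
  by apply: (is_derive_eq (derZ 8^-1 (derV (f := fun z : R => z) yn (der_id y)))); field.
have B y z : 0 < y -> y <= z -> `|F z - F y| <= 8^-1 / y.
  move=> y0 yz; have := @mvt_dominated F _ _ _ _ _ y0 yz dF dG.
  have P : forall t : R, 0 < t -> `|bern t / t ^+ 2| <= - - (8^-1 / t ^+ 2).
    move=> t t0; rewrite opprK normrM normfV (@gtr0_norm _ (t ^+ 2)) ?exprn_gt0 //.
    by rewrite ler_pM2r ?invr_gt0 ?exprn_gt0 // bern_norm.
  move=> /(_ P) /le_trans; apply; rewrite lerBlDr lerDl.
  by rewrite divr_ge0 // ltW // (lt_le_trans y0).
have [l hl] := decay_limit F _ (@cvg_cst_div R 8^-1) B.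
exists (fun y => F y - F 1 + 1), (l - F 1 + 1); split => [y y0||y y0].
- apply: (is_derive_eq (derD (derB (dF y y0) (derC y (F 1))) (derC y 1))).
  by rewrite subr0 addr0.
- by rewrite subrr add0r.
- have -> : F y - F 1 + 1 - (l - F 1 + 1) = F y - l by ring.
  exact: hl.
Qed.

End Antiderivatives.

Section Primitives.
Context {R : realType}.
Implicit Types (x y z a b d l e h : R).

(** The antiderivatives of [- bern y / y ^+ 3], vanishing at infinity, and of
    [bern y / y ^+ 2], with value [1] at [1]. *)
Definition tail3 : R -> R := sval (cid (@tail3_exists R)).
Definition prim2 : R -> R := sval (cid (@prim2_exists R)).
Definition prim2_lim : R := sval (cid (svalP (cid (@prim2_exists R)))).

Lemma der_tail3 y : 0 < y -> is_derive y 1 tail3 (- (bern y / y ^+ 3)).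
Proof. by move: y; have [] := svalP (cid (@tail3_exists R)). Qed.

Lemma tail3_norm y : 0 < y -> `|tail3 y| <= 16^-1 / y ^+ 2.
Proof. by move: y; have [] := svalP (cid (@tail3_exists R)). Qed.

Lemma prim2P : [/\ forall y, 0 < y -> is_derive y 1 prim2 (bern y / y ^+ 2),
  prim2 1 = 1 & forall y, 0 < y -> `|prim2 y - prim2_lim| <= 8^-1 / y].
Proof. exact: (svalP (cid (svalP (cid (@prim2_exists R))))). Qed.

(** The integral over []0, y]] of the fractional part divided by [s]. *)
Definition prim1 y : R := 2^-1 * ln y + bern y / y + prim2 y.

(** The integral over [[y, +oo[] of the fractional part divided by [s ^+ 2]. *)
Definition tail2 y : R := (2 * y)^-1 - bern y / y ^+ 2 + 2 * tail3 y.

Lemma der_prim1 (n : int) y : 0 < y -> n%:~R < y < n%:~R + 1 ->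
  is_derive y 1 prim1 ((y - n%:~R) / y).
Proof.
move=> y0 yn; have [dt _ _] := prim2P; have yn0 := lt0r_neq0 y0.
apply: (is_derive_eq (derD (derD (derZ 2^-1 (der_ln y0))
  (derM (is_derive_bern _ _ yn) (derV (f := fun z => z) yn0 (der_id y)))) (dt y y0))).
by field.
Qed.

Lemma der_tail2 (n : int) y : 0 < y -> n%:~R < y < n%:~R + 1 ->
  is_derive y 1 tail2 (- ((y - n%:~R) / y ^+ 2)).
Proof.
move=> y0 yn; have yn0 := lt0r_neq0 y0.
have y2 : y ^+ 2 != 0 by rewrite expf_neq0.
have y2' : 2 * y != 0 by rewrite mulf_neq0 // pnatr_eq0.
apply: (is_derive_eq (derD (derB (derV (f := fun z => 2 * z) y2' (derZ 2 (der_id y)))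
  (derM (is_derive_bern _ _ yn) (derV (f := fun z => z ^+ 2) y2 (derX 2 (der_id y)))))
  (derZ 2 (der_tail3 _ y0)))).
by field.
Qed.

Lemma continuous_prim1 y : 0 < y -> {for y, continuous prim1}.
Proof.
move=> y0; have [dt _ _] := prim2P.
apply: cvgD; last exact: is_derive_continuous (dt y y0).
apply: cvgD; first by apply: cvgM; [exact: cvg_cst|exact: continuous_ln].
apply: cvgM; first exact: continuous_bern.
by apply: cvgV; [exact: lt0r_neq0|exact: cvg_id].
Qed.

Lemma continuous_tail2 y : 0 < y -> {for y, continuous tail2}.
Proof.
move=> y0; have yn0 := lt0r_neq0 y0.
apply: cvgD; last first.
  apply: cvgM; first exact: cvg_cst.
  exact: is_derive_continuous (der_tail3 _ y0).
apply: cvgB.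
  apply: cvgV; first by rewrite mulf_neq0 // pnatr_eq0.
  by apply: cvgM; [exact: cvg_cst|exact: cvg_id].
apply: cvgM; first exact: continuous_bern.
by apply: cvgV; [rewrite expf_neq0|exact: exprn_continuous].
Qed.

Lemma prim1_le1 y : 0 < y <= 1 -> prim1 y = y.
Proof.
move=> /andP[y0 y1]; have [_ t1 _] := prim2P.
have P1 : prim1 1 = 1 by rewrite /prim1 ln1 bern1 t1 mulr0 mul0r !add0r.
have [||c _] := @MVT_segment R (fun z => prim1 z - z) (fun _ => 0) y 1 y1.
- move=> z; rewrite in_itv /= => /andP[yz z1].
  have z0 : 0 < z by exact: lt_trans yz.
  apply: (is_derive_eq (derB (der_prim1 0 _ z0 _) (der_id z))).
    by apply/andP; split; lra.
  by field; exact: lt0r_neq0.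
- apply: continuous_in_subspaceT => z; rewrite inE /= in_itv /= => /andP[yz _].
  apply: cvgB; last exact: cvg_id.
  by apply: continuous_prim1; exact: lt_le_trans yz.
rewrite P1 mul0r; lra.
Qed.

End Primitives.

(** * The autocorrelation integral *)

Section Integral.
Context {R : realType}.
Implicit Types (x y z a b d l e h s : R).
Variables mu nu : R.
Hypotheses (mu0 : 0 < mu) (nu0 : 0 < nu).

Notation leb := (@lebesgue_measure R).

Definition corr s : R := fracpart (mu * s) * fracpart (nu * s) / s ^+ 2.

Lemma corr_ge0 s : 0 <= corr s.
Proof.
by apply: divr_ge0; [apply: mulr_ge0; exact: fracpart_ge0|exact: sqr_ge0].
Qed.

Lemma measurable_fracpart (c : R) : measurable_fun setT (fun s : R => fracpart (c * s)).
Proof.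
apply: (@measurableT_comp _ _ _ _ _ _ (@fracpart R)); last first.
  by apply: measurable_funM => //; exact: measurable_cst.
apply: measurable_funB => //.
apply: nondecreasing_measurable => // x y xy.
by rewrite ler_int; exact: le_floor.
Qed.

Lemma measurable_corr : measurable_fun (`]0, +oo[ : set R) (EFin \o corr).
Proof.
apply/measurable_EFinP.
apply: measurable_funM.
  by apply: measurable_funM; apply: measurable_funTS; exact: measurable_fracpart.
apply: open_continuous_measurable_fun; first exact: interval_open.
move=> x; rewrite inE /= in_itv /= andbT => x0.
by apply: cvgV; [rewrite expf_neq0 // lt0r_neq0|exact: exprn_continuous].
Qed.

Lemma measurable_corr_sub (i : interval R) : [set` i] `<=` (`]0, +oo[ : set R) ->
  measurable_fun ([set` i] : set R) (EFin \o corr).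
Proof. by move=> h; apply: measurable_funS measurable_corr. Qed.

Lemma corr_split x y z : 0 <= x -> x <= y -> y <= z ->
  (\int[leb]_(s in `]x, z]) (corr s)%:E =
   \int[leb]_(s in `]x, y]) (corr s)%:E + \int[leb]_(s in `]y, z]) (corr s)%:E)%E.
Proof.
move=> x0 xy yz.
rewrite (@itv_bndbnd_setU _ _ (BRight x) (BRight y) (BRight z)) ?bnd_simp //.
rewrite ge0_integral_setU //=.
- rewrite -itv_bndbnd_setU ?bnd_simp //; apply: measurable_corr_sub.
  by move=> s /=; rewrite !in_itv /= andbT => /andP[h _]; apply: le_lt_trans h.
- by move=> s _; rewrite lee_fin corr_ge0.
- apply/disj_setPS => s /=; rewrite !in_itv /= => -[/andP[_ h1] /andP[h2 _]].
  by have := le_lt_trans h1 h2; rewrite ltxx.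
Qed.

(** An antiderivative of [corr] where [fracpart (mu * s) = mu * s - m], away
    from the jumps of [fracpart (nu * s)], across which it is continuous. *)
Definition cell_prim (m : nat) s : R := mu * prim1 (nu * s) + m%:R * (nu * tail2 (nu * s)).

Lemma corr_cell (m n : nat) x y : 0 < x -> x < y ->
  m%:R <= mu * x -> mu * y <= m%:R + 1 -> n%:R <= nu * x -> nu * y <= n%:R + 1 ->
  (\int[leb]_(s in `]x, y]) (corr s)%:E = (cell_prim m y - cell_prim m x)%:E)%E.
Proof.
move=> x0 xy mx my nx ny.
have P s : x < s < y -> [/\ 0 < s, m%:R < mu * s < m%:R + 1 & n%:R < nu * s < n%:R + 1].
  move=> /andP[xs sy]; split; first exact: lt_trans xs.
    have : mu * x < mu * s by rewrite ltr_pM2l.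
    have : mu * s < mu * y by rewrite ltr_pM2l.
    lra.
  have : nu * x < nu * s by rewrite ltr_pM2l.
  have : nu * s < nu * y by rewrite ltr_pM2l.
  lra.
pose g s : R := (mu * s - m%:R) * (nu * s - n%:R) / s ^+ 2.
have cg s : 0 < s -> {for s, continuous g}.
  move=> s0; apply: cvgM; last first.
    by apply: cvgV; [rewrite expf_neq0 // lt0r_neq0|exact: exprn_continuous].
  apply: cvgM; apply: cvgB; try exact: cvg_cst;
  by apply: cvgM; [exact: cvg_cst|exact: cvg_id].
have cW s : 0 < s -> {for s, continuous (cell_prim m)}.
  move=> s0; have ns : 0 < nu * s by rewrite mulr_gt0.
  have cn : {for s, continuous (fun z => nu * z)}.
    by apply: cvgM; [exact: cvg_cst|exact: cvg_id].
  apply: cvgD; apply: cvgM; try exact: cvg_cst.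
    by apply: (@continuous_comp _ _ _ (fun z => nu * z) prim1) => //; exact: continuous_prim1.
  apply: cvgM; first exact: cvg_cst.
  by apply: (@continuous_comp _ _ _ (fun z => nu * z) tail2) => //; exact: continuous_tail2.
have dW s : x < s < y -> is_derive s 1 (cell_prim m) (g s).
  move=> /P[s0 _ ns]; have nus : 0 < nu * s by rewrite mulr_gt0.
  have dn := derZ nu (der_id s).
  apply: (is_derive_eq (derD (derZ mu (der_comp (der_prim1 n _ nus ns) dn))
    (derZ m%:R (derZ nu (der_comp (der_tail2 n _ nus ns) dn))))).
  by rewrite /g -!pmulrn; field; rewrite !lt0r_neq0.
rewrite integral_itv_bndoo; last first.
  apply: measurable_corr_sub => s /=; rewrite !in_itv /= andbT => /andP[h _].
  exact: lt_trans h.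
transitivity (\int[leb]_(s in `]x, y[) (g s)%:E)%E.
  apply: eq_integral => s; rewrite inE /= in_itv /= => /P[s0 ms ns].
  have E (k : nat) (t : R) : k%:R < t < k%:R + 1 -> fracpart t = t - k%:R.
    by move=> /andP[h1 h2]; rewrite (@floor_cell _ _ k) // -pmulrn ltW.
  by rewrite /= /corr (E m _ ms) (E n _ ns).
rewrite -(@integral_itv_bndoo _ _ _ _ true false); last first.
  apply/measurable_EFinP; apply: open_continuous_measurable_fun; first exact: interval_open.
  by move=> s; rewrite inE /= in_itv /= => /P[s0 _ _]; exact: cg.
rewrite (@continuous_FTC2 _ g (cell_prim m) x y xy) //.
- apply: continuous_in_subspaceT => s; rewrite inE /= in_itv /= => /andP[xs _].
  by apply: cg; exact: lt_le_trans xs.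
- split.
  + by move=> s; rewrite in_itv /= => /dW[].
  + by apply: cvg_at_right_filter; exact: cW.
  + by apply: cvg_at_left_filter; apply: cW; exact: lt_trans xy.
- by move=> s; rewrite in_itv /= => /dW[_ <-]; rewrite derive1E.
Qed.

(** Induction over the breakpoints of [fracpart (nu * s)] met on the way. *)
Lemma corr_strip (m : nat) x y : 0 < x -> x <= y ->
  m%:R <= mu * x -> mu * y <= m%:R + 1 ->
  (\int[leb]_(s in `]x, y]) (corr s)%:E = (cell_prim m y - cell_prim m x)%:E)%E.
Proof.
move=> x0 xy mx my.
suff H (n : nat) : forall y, x <= y -> mu * y <= m%:R + 1 -> nu * y <= n%:R + 1 ->
    (\int[leb]_(s in `]x, y]) (corr s)%:E = (cell_prim m y - cell_prim m x)%:E)%E.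
  apply: (H (Num.trunc (nu * y))) => //.
  have /truncn_itv/andP[_ /ltW] : 0 <= nu * y by rewrite mulr_ge0 // ltW // (lt_le_trans x0).
  by rewrite -natr1.
elim: n => [|n IH] {xy my}y xy my ny.
  move: xy; rewrite le_eqVlt => /predU1P[<-|xy].
    by rewrite set_itvoc0 integral_set0 subrr.
  by apply: (@corr_cell m 0) => //; rewrite mulr_ge0 // ltW.
have [yn|yn] := leP (nu * y) (n%:R + 1); first exact: IH.
have [xn|xn] := leP (n%:R + 1) (nu * x).
  move: xy; rewrite le_eqVlt => /predU1P[<-|xy].
    by rewrite set_itvoc0 integral_set0 subrr.
  by apply: (@corr_cell m n.+1) => //; rewrite -natr1.
pose z := (n%:R + 1) / nu.
have nz : nu * z = n%:R + 1 by rewrite /z mulrC divfK // gt_eqF.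
have xz : x < z by rewrite -(ltr_pM2l nu0) nz.
have zy : z < y by rewrite -(ltr_pM2l nu0) nz.
have mz : mu * z <= m%:R + 1 by apply: le_trans my; rewrite ler_pM2l // ltW.
rewrite (@corr_split x z y) ?(ltW xz) ?(ltW zy) ?(ltW x0) //.
rewrite (IH z) ?(ltW xz) ?nz // (@corr_cell m n.+1 z y) //.
- by rewrite -EFinD; congr EFin; ring.
- exact: lt_trans xz.
- by apply: le_trans mx _; rewrite ler_pM2l // ltW.
- by rewrite nz natr1.
Qed.

(** The sum of the increments of [cell_prim] over the first [M] strips, after
    summation by parts. *)
Definition corr_partial (M : nat) : R :=
  mu * prim1 (nu / mu * M%:R) + nu * (M%:R * tail2 (nu / mu * M%:R)
     - \sum_(0 <= m < M) tail2 (nu / mu * m.+1%:R)).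

Lemma corr_upto (M : nat) :
  (\int[leb]_(s in `]0%R, (M.+1%:R / mu)%R]) (corr s)%:E = (corr_partial M.+1)%:E)%E.
Proof.
have cst_mu (k : nat) : mu * (k%:R / mu) = k%:R by rewrite mulrC divfK // gt_eqF.
have cst_nu (k : nat) : nu * (k%:R / mu) = nu / mu * k%:R by rewrite mulrCA mulrC.
have le_mu (k : nat) : k%:R / mu <= k.+1%:R / mu.
  by rewrite ler_pM2r ?invr_gt0 // ler_nat.
elim: M => [|M IH]; last first.
  rewrite (@corr_split 0 (M.+1%:R / mu)) ?le_mu ?divr_ge0 ?(ltW mu0) // IH.
  rewrite (@corr_strip M.+1) ?divr_gt0 ?cst_mu ?natr1 //.
  rewrite -EFinD; congr EFin; rewrite /cell_prim /corr_partial !cst_nu.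
  rewrite [in RHS]big_nat_recr //= -[M.+2%:R in X in _ = _ + _ * (X * _ - _)]natr1; ring.
(* Up to [x] neither fractional part has jumped, and [corr] is constant. *)
pose x := Num.min mu^-1 nu^-1.
have x0 : 0 < x by rewrite lt_min !invr_gt0 mu0.
have mx : mu * x <= 1 by rewrite -ler_pdivlMl // mulr1 ge_min lexx.
have nx : nu * x <= 1 by rewrite -ler_pdivlMl // mulr1 ge_min lexx orbT.
have xm : x <= 1 / mu by rewrite mul1r ge_min lexx.
rewrite (@corr_split 0 x) ?(ltW x0) //.
rewrite (@corr_strip 0 x) ?mulr_ge0 ?cst_mu ?add0r // ?(ltW mu0) ?(ltW x0) //.
have -> : (\int[leb]_(s in `]0%R, x]) (corr s)%:E = (mu * nu * x)%:E)%E.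
  rewrite integral_itv_bndoo; last first.
    apply: measurable_corr_sub => s /=; rewrite !in_itv /= andbT => /andP[h _] //.
  rewrite (eq_integral (fun=> (mu * nu)%:E)); last first.
    move=> s; rewrite inE /= in_itv /= => /andP[s0 sx].
    have E (t : R) : 0 < t < 1 -> fracpart t = t.
      by move=> /andP[h1 h2]; rewrite (@floor_cell _ _ 0) ?subr0 // add0r (ltW h1).
    rewrite /corr !E ?mulr_gt0 //=.
    - by congr EFin; field; exact: lt0r_neq0.
    - by apply: lt_le_trans nx; rewrite ltr_pM2l.
    - by apply: lt_le_trans mx; rewrite ltr_pM2l.
  rewrite integral_cst //= lebesgue_measure_itv /= lte_fin x0 -EFinB subr0.
  by rewrite -EFinM.
rewrite -EFinD; congr EFin; rewrite /cell_prim /corr_partial cst_nu big_nat1.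
rewrite (@prim1_le1 _ (nu * x)) ?mulr_gt0 //; ring.
Qed.

End Integral.

Section IntegralLimit.
Context {R : realType}.
Implicit Types (x y z a b d l e h s : R).

Notation leb := (@lebesgue_measure R).

Lemma integral_inv_square :
  (\int[leb]_(s in `[1%R, +oo[) (s ^- 2)%:E = 1%:E)%E.
Proof.
have D (s : R) : 0 < s -> is_derive s 1 (fun z : R => - z^-1) (s ^- 2).
  move=> s0; have sn := lt0r_neq0 s0.
  by apply: (is_derive_eq (derN (derV (f := fun z => z) sn (der_id s)))); field.
have p1 s : 1 <= s -> 0 < s by exact: lt_le_trans.
rewrite (@ge0_continuous_FTC2y R (fun s => s ^- 2) (fun s => - s^-1) 1 0).
- by rewrite -EFinB invr1 opprK add0r.
- by move=> s _; rewrite invr_ge0 sqr_ge0.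
- apply: continuous_in_subspaceT => s; rewrite inE /= in_itv /= andbT => /p1 s0.
  by apply: cvgV; [rewrite expf_neq0 // lt0r_neq0|exact: exprn_continuous].
- apply/cvgrPdist_le => e e0; near=> s.
  have s0 : 0 < s by near: s; exact: nbhs_pinfty_gt.
  have es : e^-1 <= s by near: s; apply: nbhs_pinfty_ge; exact: num_real.
  by rewrite sub0r opprK ger0_norm ?invr_ge0 ?(ltW s0) // invf_ple ?posrE.
- by move=> s /ltW/p1/D[].
- by apply: cvg_at_right_filter; exact: (is_derive_continuous _ _ _ (D 1 ltr01)).
- by move=> s; rewrite in_itv /= andbT => /ltW/p1/D[_ <-]; rewrite derive1E.
Unshelve. all: by end_near. Qed.

Variables mu nu : R.
Hypotheses (mu0 : 0 < mu) (nu0 : 0 < nu).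

Lemma fracpart_le s : 0 <= s -> fracpart s <= s.
Proof. by move=> s0; rewrite /fracpart lerBlDr lerDl ler0z floor_ge0. Qed.

Lemma corr_le_cst s : 0 < s -> corr mu nu s <= mu * nu.
Proof.
move=> s0; rewrite /corr ler_pdivrMr ?exprn_gt0 //.
have -> : mu * nu * s ^+ 2 = (mu * s) * (nu * s) by ring.
by apply: ler_pM; rewrite ?fracpart_ge0 // fracpart_le // ltW // mulr_gt0.
Qed.

Lemma corr_le_inv_square s : 0 < s -> corr mu nu s <= s ^- 2.
Proof.
move=> s0; rewrite /corr ler_piMl ?invr_ge0 ?sqr_ge0 //.
by rewrite mulr_ile1 ?fracpart_ge0 // ltW // fracpart_lt1.
Qed.

Lemma corr_integral_le :
  (\int[leb]_(s in `]0%R, +oo[) (corr mu nu s)%:E <= (mu * nu + 1)%:E)%E.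
Proof.
have mc := @measurable_corr_sub R mu nu.
rewrite (@itv_bndbnd_setU _ _ (BRight (0 : R)) (BRight (1 : R)) +oo%O) ?bnd_simp //.
rewrite ge0_integral_setU //=; last 3 first.
- rewrite -itv_bndbnd_setU ?bnd_simp //; exact: measurable_corr.
- by move=> s _; rewrite lee_fin corr_ge0.
- apply/disj_setPS => s /=; rewrite !in_itv /= andbT => -[/andP[_ h1] h2].
  by have := le_lt_trans h1 h2; rewrite ltxx.
rewrite EFinD; apply: leeD.
  apply: (@le_trans _ _ (\int[leb]_(s in `]0%R, 1%R]) (mu * nu)%:E)%E).
    apply: ge0_le_integral => //.
    - by move=> s _; rewrite lee_fin corr_ge0.
    - by apply: mc => s /=; rewrite !in_itv /= andbT => /andP[].
    - by move=> s /=; rewrite in_itv /= => /andP[s0 _]; rewrite lee_fin corr_le_cst.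
  by rewrite integral_cst //= lebesgue_measure_itv /= lte_fin ltr01 -EFinB subr0 mule1.
rewrite -integral_inv_square -integral_itv_obnd_cbnd; last first.
  apply/measurable_EFinP; apply: open_continuous_measurable_fun; first exact: interval_open.
  move=> s; rewrite inE /= in_itv /= andbT => s1.
  have s0 : 0 < s by exact: lt_trans s1.
  by apply: cvgV; [rewrite expf_neq0 // lt0r_neq0|exact: exprn_continuous].
apply: ge0_le_integral => //.
- by move=> s _; rewrite lee_fin corr_ge0.
- by apply: mc => s /=; rewrite !in_itv /= !andbT => /(lt_trans _); apply.
- apply/measurable_EFinP; apply: open_continuous_measurable_fun; first exact: interval_open.
  move=> s; rewrite inE /= in_itv /= andbT => s1.
  have s0 : 0 < s by exact: lt_trans s1.
  by apply: cvgV; [rewrite expf_neq0 // lt0r_neq0|exact: exprn_continuous].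
- move=> s /=; rewrite in_itv /= andbT => s1; rewrite lee_fin corr_le_inv_square //.
  exact: lt_trans s1.
Qed.

Definition corr_int : R := (\int[leb]_(s in `]0, +oo[) corr mu nu s)%R.

Lemma corr_int_EFin :
  (\int[leb]_(s in `]0%R, +oo[) (corr mu nu s)%:E = corr_int%:E)%E.
Proof.
rewrite /corr_int /Rintegral fineK // ge0_fin_numE.
  exact: le_lt_trans corr_integral_le (ltry _).
by apply: integral_ge0 => s _; rewrite lee_fin corr_ge0.
Qed.

Lemma corr_int_bound : 0 <= corr_int <= mu * nu + 1.
Proof.
rewrite -!lee_fin -corr_int_EFin corr_integral_le andbT.
by apply: integral_ge0 => s _; rewrite lee_fin corr_ge0.
Qed.

Lemma corr_partial_cvg : (fun M => corr_partial mu nu M.+1) @ \oo --> corr_int.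
Proof.
pose F (M : nat) : set R := `]0, M.+1%:R / mu]%classic.
have FU : \bigcup_i F i = `]0, +oo[%classic.
  apply/seteqP; split => s /=; rewrite in_itv /= ?andbT.
    by move=> [i _]; rewrite /F /= in_itv /= => /andP[].
  move=> s0; exists (Num.trunc (s * mu)) => //; rewrite /F /= in_itv /= s0 /=.
  rewrite ler_pdivlMr //.
  by have /truncn_itv/andP[_ /ltW] : 0 <= s * mu by rewrite mulr_ge0 // ltW.
suff /fine_cvgP[_] : (fun M => (corr_partial mu nu M.+1)%:E) @ \oo --> corr_int%:E by [].
have E : (fun i => (\int[leb]_(x in F i) (EFin \o corr mu nu) x)%E) =
    (fun M => (corr_partial mu nu M.+1)%:E).
  by apply/funext => M; rewrite -corr_upto.
rewrite -E -corr_int_EFin // -FU; apply: ge0_nondecreasing_set_cvg_integral.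
- move=> m n mn; apply/subsetPset => s; rewrite /F /= !in_itv /= => /andP[-> h] /=.
  by apply: le_trans h _; rewrite ler_pM2r ?invr_gt0 // ler_nat.
- by move=> i; exact: measurable_itv.
- move=> i; apply: measurable_corr_sub => s; rewrite /F /= !in_itv /= andbT.
  by move=> /andP[].
- by move=> i s _; rewrite lee_fin corr_ge0.
Qed.

End IntegralLimit.

Section Formula.
Context {R : realType}.
Implicit Types (x y z a b d l e h s r : R).

Definition tail3_part r (N : nat) : R := series (fun n : nat => tail3 (r * n.+1%:R)) N.
Definition tail3_sum r : R := limn (tail3_part r).

Lemma tail3_sum_cvg_err r : 0 < r -> tail3_part r @ \oo --> tail3_sum r /\
  forall N, (0 < N)%N -> `|tail3_sum r - tail3_part r N| <= (16^-1 / r ^+ 2) / N%:R.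
Proof.
move=> r0; have [|l [cl hl]] := @square_tail R
    (fun n : nat => tail3 (r * n.+1%:R)) (16^-1 / r ^+ 2).
  move=> n; have rn : 0 < r * n.+1%:R by rewrite mulr_gt0.
  by have := tail3_norm _ rn; rewrite exprMn invfM mulrA.
have E : tail3_sum r = l by exact: cvg_lim cl.
by rewrite E.
Qed.

Lemma der_tail3_part r N : 0 < r ->
  is_derive r 1 (fun t => tail3_part t N) (- (bpart r N / r ^+ 3)).
Proof.
move=> r0; elim: N => [|N IH].
  apply: (@is_derive_near _ (fun _ => 0) _ _ _ 1 ltr01).
    by move=> y _; rewrite /tail3_part /series /= big_nil.
  apply: (is_derive_eq (derC r 0)).
  by rewrite /bpart /series /= big_nil mul0r oppr0.
have n0 : (0 : R) < N.+1%:R by rewrite ltr0n.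
have rn : 0 < r * N.+1%:R by rewrite mulr_gt0.
have d1 : is_derive r 1 (fun t => t * N.+1%:R) (N.+1%:R : R).
  by apply: (is_derive_eq (derM (der_id r) (derC r N.+1%:R))); rewrite mul1r mulr0 addr0.
have D := derD IH (der_comp (g := fun t => t * N.+1%:R) (der_tail3 _ rn) d1).
apply: (@is_derive_near _ _ _ _ _ 1 ltr01 _ (is_derive_eq D _)).
  by move=> y _; rewrite /tail3_part /series /= big_nat_recr.
rewrite /bpart /series /= big_nat_recr //= [r * _]mulrC.
move: (bern _) => w; field; rewrite lt0r_neq0 //=; exact: lt0r_neq0.
Qed.

(** The mean value theorem for the partial sums, whose derivatives converge
    uniformly, with a limit continuous at [r]. *)
Lemma der_tail3_sum r : 0 < r -> is_derive r 1 tail3_sum (- (bsum r / r ^+ 3)).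
Proof.
move=> r0; have rn := lt0r_neq0 r0.
pose phi t : R := - (bsum t / t ^+ 3).
have cphi : {for r, continuous phi}.
  apply: cvgN; apply: cvgM; first exact: continuous_bsum.
  by apply: cvgV; [rewrite expf_neq0|exact: exprn_continuous].
apply/is_derive_epsP => e e0.
have e2 : 0 < e / 2 by rewrite divr_gt0.
have [dl dl0 Hd] := (continuous_epsP _ _).1 cphi (e / 2) e2.
exists (Num.min dl (r / 2)); first by rewrite lt_min dl0 divr_gt0.
move=> h; rewrite lt_min => /andP[hdl hr].
have rh : 0 < r + h by move: hr; rewrite ltr_norml => /andP[? ?]; lra.
have [cr _] := tail3_sum_cvg_err _ r0; have [crh _] := tail3_sum_cvg_err _ rh.
have [N0 HN0] := (cvgn_epsP _ _).1 (@cvg_cst_div R (r ^- 3)) (e / 2) e2.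
apply: (@cvgn_le_bound _ (fun N => `|tail3_part (r + h) N - tail3_part r N - phi r * h|) _ _ N0.+1).
  by apply: cvg_norm; apply: cvgB; [apply: cvgB|exact: cvg_cst].
move=> N NN0.
have N0' : (0 < N)%N by apply: leq_ltn_trans NN0.
have NR : (0 : R) < N%:R by rewrite ltr0n.
have pos t : r <= t <= r + h \/ r + h <= t <= r -> r / 2 <= t.
  by move: hr; rewrite ltr_norml => /andP[? ?] [] /andP[? ?]; lra.
have [|c [hc ->]] := @mvt_between R (fun t => tail3_part t N) (fun t => - (bpart t N / t ^+ 3)) r (r + h).
  by move=> c /pos hc; apply: der_tail3_part; apply: lt_le_trans hc; rewrite divr_gt0.
have rc := pos c hc; have c0 : 0 < c by apply: lt_le_trans rc; rewrite divr_gt0.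
rewrite [r + h]addrC addrK -mulrBl normrM ler_wpM2r //.
have -> : - (bpart c N / c ^+ 3) - phi r =
    (bsum c - bpart c N) / c ^+ 3 + (phi c - phi r) by rewrite /phi; ring.
apply: le_trans (ler_normD _ _) _; rewrite [leRHS](splitr e).
apply: lerD; last first.
  apply: Hd; apply: le_lt_trans hdl.
  by case: hc => /andP[? ?]; [rewrite !ger0_norm; lra|rewrite !ler0_norm; lra].
have := HN0 N (ltnW NN0); rewrite subr0 => /(le_trans (ler_norm _)); apply: le_trans.
rewrite normrM normfV (@gtr0_norm _ (c ^+ 3)) ?exprn_gt0 //.
have -> : r ^- 3 / N%:R = 8^-1 / N%:R * ((r / 2) ^+ 3)^-1 by field; rewrite rn lt0r_neq0.
apply: ler_pM.
- exact: normr_ge0.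
- by rewrite invr_ge0 exprn_ge0 // ltW.
- exact: bsum_err.
have r2 : 0 < r / 2 by rewrite divr_gt0.
rewrite lef_pV2 ?posrE; [|exact: exprn_gt0|exact: exprn_gt0].
by rewrite ler_pXn2r // nnegrE ltW.
Qed.

Definition harm_part (M : nat) : R := (ln M%:R - \sum_(0 <= m < M) m.+1%:R^-1) / 2.

(** What is left of [corr_partial / mu] once the harmonic sums are set apart:
    each summand has a limit of its own. *)
Definition corr_rest r (M : nat) : R :=
  ln r / 2 + prim2 (r * M%:R) + 2^-1 + 2 * r * (M%:R * tail3 (r * M%:R))
  + bpart r M / r - 2 * r * tail3_part r M.

Definition corr_rest_lim r : R :=
  ln r / 2 + prim2_lim + 2^-1 + bsum r / r - 2 * r * tail3_sum r.

(** The corners of the two primitives cancel; what remains of the boundary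
    terms are [prim2] and [tail3], which have limits. *)
Lemma corr_partialE (mu nu : R) M : 0 < mu -> 0 < nu ->
  corr_partial mu nu M.+1 = mu * (harm_part M.+1 + corr_rest (nu / mu) M.+1).
Proof.
move=> mu0 nu0; set r := nu / mu.
have r0 : 0 < r by rewrite divr_gt0.
have rn := lt0r_neq0 r0.
have -> : corr_partial mu nu M.+1 = mu * (prim1 (r * M.+1%:R)
   + r * (M.+1%:R * tail2 (r * M.+1%:R) - \sum_(0 <= m < M.+1) tail2 (r * m.+1%:R))).
  rewrite /corr_partial -/r; set S := (_ - _); rewrite /r; field; exact: lt0r_neq0.
congr (_ * _).
have -> : \sum_(0 <= m < M.+1) tail2 (r * m.+1%:R) =
   (2 * r)^-1 * (\sum_(0 <= m < M.+1) m.+1%:R^-1) - bpart r M.+1 / r ^+ 2 + 2 * tail3_part r M.+1.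
  rewrite /bpart /tail3_part /series /= !mulr_sumr mulr_suml -sumrB -big_split /=.
  apply: eq_bigr => i _; rewrite /tail2 [i.+1%:R * r]mulrC.
  have i0 : i.+1%:R != 0 :> R by rewrite pnatr_eq0.
  move: (bern _) (tail3 _) => w t; move: (i.+1%:R) i0 => n i0.
  by field; rewrite rn i0.
have M0 : (0 : R) < M.+1%:R by rewrite ltr0n.
rewrite /prim1 /tail2 /harm_part /corr_rest lnM ?posrE //.
set S := \sum_(0 <= m < M.+1) _; set B := bpart _ _; set Y := tail3_part _ _.
move: (ln r) (ln _) (bern _) (prim2 _) (tail3 _) S B Y => lr lM w t et S B Y.
have Mn := lt0r_neq0 M0; move: (M.+1%:R) Mn => m Mn.
by field; rewrite rn Mn.
Qed.

Lemma corr_rest_cvg r : 0 < r ->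
  (fun M => corr_rest r M.+1) @ \oo --> corr_rest_lim r.
Proof.
move=> r0; have [_ _ tl] := @prim2P R.
have shift (u : nat -> R) l : u @ \oo --> l -> (fun n => u n.+1) @ \oo --> l.
  by move=> ul; rewrite (cvg_shiftS u).
have small (u : nat -> R) l c : (forall M, `|u M - l| <= c / M.+1%:R) -> u @ \oo --> l.
  move=> H; apply/cvgn_epsP => e e0.
  have [N HN] := (cvgn_epsP _ _).1 (@cvg_cst_div R c) e e0; exists N => n Nn.
  apply: le_trans (H n) _; have := HN n.+1 (leqW Nn); rewrite subr0.
  exact: le_trans (ler_norm _).
have posM (M : nat) : 0 < r * M.+1%:R by rewrite mulr_gt0.
apply: cvgB; last first.
  by apply: cvgM; [exact: cvg_cst|apply: shift; have [] := tail3_sum_cvg_err _ r0].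
apply: cvgD; last by apply: cvgM; [apply: shift; exact: bpart_cvg|exact: cvg_cst].
rewrite -[X in _ --> X]addr0; apply: cvgD; last first.
  rewrite -[X in _ --> X](mulr0 (2 * r)); apply: cvgM; first exact: cvg_cst.
  apply: (small _ _ (16^-1 / r ^+ 2)) => M; rewrite subr0 normrM ger0_norm //.
  have := tail3_norm _ (posM M); rewrite -(ler_pM2l (ltr0Sn R M)) => /le_trans; apply.
  have : M.+1%:R != 0 :> R by rewrite pnatr_eq0.
  move: (M.+1%:R) => m m0; rewrite le_eqVlt; apply/orP; left; apply/eqP.
  by field; rewrite m0 lt0r_neq0.
apply: cvgD; last exact: cvg_cst.
apply: cvgD; first exact: cvg_cst.
apply: (small _ _ (8^-1 / r)) => M.
by apply: le_trans (tl _ (posM M)) _; rewrite invfM mulrA.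
Qed.

(** At [mu = nu = 1] every other term of the partial integral converges, so
    the harmonic sums do too; their limit enters the constant of
    [corr_int_formula]. *)
Lemma harm_part_cvg : exists K : R, (fun M => harm_part M.+1) @ \oo --> K.
Proof.
exists (corr_int 1 1 - corr_rest_lim 1).
have -> : (fun M => harm_part M.+1) =
    (fun M => corr_partial 1 1 M.+1 - corr_rest 1 M.+1).
  by apply/funext => M; rewrite corr_partialE ?ltr01 // divr1 mul1r addrK.
by apply: cvgB; [exact: corr_partial_cvg|exact: corr_rest_cvg].
Qed.

Lemma corr_int_formula : exists C : R, forall mu nu : R, 0 < mu -> 0 < nu ->
  let r := nu / mu in
  corr_int mu nu = mu * (ln r / 2 + C + bsum r / r - 2 * r * tail3_sum r).
Proof.
have [K cK] := harm_part_cvg; exists (K + prim2_lim + 2^-1) => mu nu mu0 nu0 r.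
have r0 : 0 < r by rewrite divr_gt0.
have c1 := corr_partial_cvg _ _ mu0 nu0.
have c2 : (fun M => corr_partial mu nu M.+1) @ \oo --> mu * (K + corr_rest_lim r).
  have -> : (fun M => corr_partial mu nu M.+1) =
      (fun M => mu * (harm_part M.+1 + corr_rest r M.+1)).
    by apply/funext => M; rewrite corr_partialE.
  apply: cvgM; first exact: cvg_cst.
  by apply: cvgD => //; exact: corr_rest_cvg.
rewrite -(cvg_lim (@Rhausdorff R) c1) (cvg_lim (@Rhausdorff R) c2).
by rewrite /corr_rest_lim; ring.
Qed.

End Formula.

(** * The reciprocity formula *)

Section Reciprocity.
Context {R : realType}.
Implicit Types (x y z a b d l e h s r : R).

Lemma autocorr_corr_int x : autocorr x = corr_int 1 x /\ autocorr x = corr_int x 1.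
Proof.
split; apply: eq_Rintegral => s _; rewrite /corr mul1r //.
by rewrite [fracpart s * _]mulrC.
Qed.

Definition autocorr_cst : R := sval (cid (@corr_int_formula R)).

(** The continuously differentiable part of [autocorr] on the positive
    half-line. *)
Definition regular_part x : R := ln x / 2 + autocorr_cst - 2 * x * tail3_sum x.

Lemma autocorrE x : 0 < x -> autocorr x = bsum x / x + regular_part x.
Proof.
move=> x0; have [-> _] := autocorr_corr_int x.
rewrite (svalP (cid (@corr_int_formula R)) 1 x) // divr1 mul1r -/autocorr_cst.
by rewrite /regular_part; ring.
Qed.

Lemma autocorr_reciprocal x : 0 < x -> autocorr x = x * autocorr x^-1.
Proof.
move=> x0; have xi : 0 < x^-1 by rewrite invr_gt0.
have [_ ->] := autocorr_corr_int x.
rewrite (svalP (cid (@corr_int_formula R)) x 1) // mul1r -/autocorr_cst.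
by rewrite (autocorrE _ xi) /regular_part; ring.
Qed.

Lemma autocorr_bound x : 0 < x -> 0 <= autocorr x <= x + 1.
Proof.
move=> x0; have [-> _] := autocorr_corr_int x.
by have := @corr_int_bound R 1 x ltr01 x0; rewrite mul1r.
Qed.

Lemma der_regular_part x : 0 < x ->
  is_derive x 1 regular_part ((2 * x)^-1 - 2 * tail3_sum x + 2 * bsum x / x ^+ 2).
Proof.
move=> x0; have xn := lt0r_neq0 x0.
apply: (is_derive_eq (derB (derD (derM (der_ln x0) (derC x 2^-1)) (derC x autocorr_cst))
  (derM (derZ 2 (der_id x)) (der_tail3_sum _ x0)))).
by field.
Qed.

Lemma continuous_autocorr x : 0 < x -> {for x, continuous (@autocorr R)}.
Proof.
move=> x0; apply/continuous_epsP => e e0.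
have c : {for x, continuous (fun y => bsum y / y + regular_part y)}.
  apply: cvgD; last exact: is_derive_continuous (der_regular_part _ x0).
  apply: cvgM; first exact: continuous_bsum.
  by apply: cvgV; [exact: lt0r_neq0|exact: cvg_id].
have [dl dl0 H] := (continuous_epsP _ _).1 c e e0.
exists (Num.min dl x); first by rewrite lt_min dl0.
move=> y; rewrite lt_min => /andP[h1 h2].
rewrite !autocorrE //; first exact: H.
by move: h2; rewrite ltr_norml => /andP[? ?]; lra.
Qed.

Lemma derivable_autocorr x : 0 < x ->
  derivable (@autocorr R) x 1 <-> derivable (@bsum R) x 1.
Proof.
move=> x0; have xn := lt0r_neq0 x0.
have near y : `|y - x| < x -> 0 < y by rewrite ltr_norml => /andP[? ?]; lra.
split=> /derivableE[d D]; apply/derivableE.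
  have D' := derM (der_id x) (derB D (der_regular_part _ x0)).
  eexists; apply: is_derive_near x0 _ D' => y /near y0.
  rewrite autocorrE // addrK; field; exact: lt0r_neq0.
have D' := derD (derM D (derV (f := fun z => z) xn (der_id x))) (der_regular_part _ x0).
by eexists; apply: is_derive_near x0 _ D' => y /near y0; rewrite autocorrE.
Qed.

(** The defect of [bsum] with respect to the exact transformation rule of
    weight [3], and the nonlogarithmic part of its derivative. *)
Definition recip_gap x : R := x ^+ 2 * regular_part x^-1 - x * regular_part x.

Definition recip_rest x : R := - autocorr x - 3 * x ^+ 2 * bsum x^-1
  - x * ln x / 2 + (autocorr_cst - 2^-1) * (1 + x).

Lemma bsum_reciprocal x : 0 < x -> bsum x = x ^+ 3 * bsum x^-1 + recip_gap x.
Proof.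
move=> x0; have xn := lt0r_neq0 x0; have xi : 0 < x^-1 by rewrite invr_gt0.
have := autocorr_reciprocal _ x0; rewrite (autocorrE _ x0) (autocorrE _ xi) invrK.
move=> E; rewrite /recip_gap.
have -> : bsum x = x * (bsum x / x + regular_part x) - x * regular_part x by field.
by rewrite E; ring.
Qed.

(** In this derivative [autocorr] and [bsum] occur undifferentiated, so it is
    continuous on []0, +oo[]; its only singularity is logarithmic, at [0]. *)
Lemma der_recip_gap x : 0 < x ->
  is_derive x 1 recip_gap (ln x / 2 + recip_rest x).
Proof.
move=> x0; have xn := lt0r_neq0 x0; have xi : 0 < x^-1 by rewrite invr_gt0.
have dV := derV (f := fun z => z) xn (der_id x).
apply: (is_derive_eq (derB (derM (derX 2 (der_id x))
    (der_comp (g := fun z => z^-1) (der_regular_part _ xi) dV))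
  (derM (der_id x) (der_regular_part _ x0)))).
rewrite /recip_rest.
(* Eliminating [tail3_sum] in favour of [autocorr] through the formula for
   [autocorr] and its reciprocity leaves a bounded expression at [0]. *)
have E1 : tail3_sum x = (ln x / 2 + autocorr_cst + bsum x / x - autocorr x) / (2 * x).
  by rewrite (autocorrE _ x0) /regular_part; field.
have E2 : tail3_sum x^-1 =
    (ln x^-1 / 2 + autocorr_cst + bsum x^-1 * x - autocorr x / x) * x / 2.
  rewrite (autocorr_reciprocal _ x0) (autocorrE _ xi) /regular_part invrK.
  by field.
rewrite /regular_part E1 E2 lnV ?posrE //; by field.
Qed.

(** Here [28 = 1 + 3 ^ 3], from the reciprocity formula and [`|bsum| <= 1]. *)
Lemma recip_gap_bound x : 0 < x <= 3 -> `|recip_gap x| <= 28.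
Proof.
move=> /andP[x0 x3].
have -> : recip_gap x = bsum x - x ^+ 3 * bsum x^-1.
  by rewrite {1}(bsum_reciprocal _ x0); ring.
apply: le_trans (ler_normB _ _) _.
have := bsum_norm x; have := bsum_norm x^-1; rewrite normrM.
have : `|x ^+ 3| <= 27.
  rewrite ger0_norm ?exprn_ge0 ?(ltW x0) //.
  have -> : 27 = 3 ^+ 3 :> R by ring.
  by rewrite ler_pXn2r // nnegrE // ltW.
have := normr_ge0 (bsum x^-1); have := normr_ge0 (x ^+ 3).
move: `|x ^+ 3| `|bsum x^-1| `|bsum x| => u v w; nra.
Qed.

Lemma xlnx_ge x : 0 < x -> -1 <= x * ln x.
Proof.
move=> x0; have xi : 0 < x^-1 by rewrite invr_gt0.
have := ln_sublinear xi; rewrite lnV ?posrE // => H.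
have : x * (- ln x) <= x * x^-1 by rewrite ler_pM2l // ltW.
by rewrite mulfV ?gt_eqF //; lra.
Qed.

Lemma recip_rest_bound : exists2 K : R, 0 < K &
  forall x, 0 < x <= 3 -> `|recip_rest x| <= K.
Proof.
exists (100 + 4 * `|autocorr_cst|) => [|x /andP[x0 x3]].
  by have := normr_ge0 autocorr_cst; lra.
have /andP[a0 a1] := autocorr_bound _ x0.
have b : `|3 * x ^+ 2 * bsum x^-1| <= 27.
  rewrite normrM ger0_norm; last by rewrite mulr_ge0 // sqr_ge0.
  have := bsum_norm x^-1; have := normr_ge0 (bsum x^-1).
  by move: `|_| => u; nra.
have l1 := xlnx_ge _ x0.
have l2 : x * ln x <= 9 by have := ln_sublinear x0; nra.
have c : `|autocorr_cst * (1 + x)| <= 4 * `|autocorr_cst|.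
  rewrite normrM mulrC ler_wpM2r // ger0_norm; lra.
rewrite /recip_rest.
move: b c; rewrite !ler_norml => /andP[? ?] /andP[? ?]; apply/andP; split; lra.
Qed.

Lemma continuous_recip_rest x : 0 < x -> {for x, continuous recip_rest}.
Proof.
move=> x0; have xn := lt0r_neq0 x0.
apply: cvgD; last first.
  by apply: cvgM; [exact: cvg_cst|apply: cvgD; [exact: cvg_cst|exact: cvg_id]].
apply: cvgB; last first.
  apply: cvgM; last exact: cvg_cst.
  by apply: cvgM; [exact: cvg_id|exact: continuous_ln].
apply: cvgB; first by apply: cvgN; exact: continuous_autocorr.
apply: cvgM.
  by apply: cvgM; [exact: cvg_cst|exact: exprn_continuous].
apply: (@continuous_comp _ _ _ (fun z : R => z^-1) bsum); last exact: continuous_bsum.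
by apply: cvgV => //; exact: cvg_id.
Qed.

Lemma autocorr0 : autocorr (0 : R) = 0.
Proof.
rewrite /autocorr (@eq_Rintegral _ _ _ _ _ (fun=> 0)); last first.
  move=> t _; rewrite mul0r /fracpart -[0]/(0%:~R) floor0 subrr mulr0 mul0r //.
by rewrite /Rintegral integral0.
Qed.

Lemma autocorr_ge_ln x : 1 <= x -> ln x / 2 + autocorr_cst - 2 <= autocorr x.
Proof.
move=> x1; have x0 : 0 < x by lra.
have x2 : 0 < x ^+ 2 by exact: exprn_gt0.
rewrite autocorrE // /regular_part.
have b1 : - 1 <= bsum x / x.
  rewrite ler_pdivlMr //; have := bsum_norm x; rewrite ler_norml => /andP[? _]; lra.
have [_ /(_ 1%N isT)] := tail3_sum_cvg_err _ x0.
rewrite /tail3_part /series /= big_nat1 mulr1 divr1 => h1.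
have h2 := tail3_norm _ x0.
have : tail3_sum x <= 2 * (16^-1 / x ^+ 2).
  move: h1 h2; rewrite !ler_norml => /andP[? ?] /andP[? ?]; lra.
move=> h3; have : x * tail3_sum x <= x * (2 * (16^-1 / x ^+ 2)) by rewrite ler_pM2l.
have -> : x * (2 * (16^-1 / x ^+ 2)) = 8^-1 / x by field; exact: lt0r_neq0.
have : 8^-1 / x <= 2^-1 by rewrite ler_pdivrMr //; lra.
rewrite -[2 * x * _]mulrA; move: b1.
move: (bsum x / x) (8^-1 / x) (x * _) => u v w; lra.
Qed.

(** By reciprocity the difference quotient at [h] is [autocorr h^-1], which
    grows like [ln h^-1 / 2]. *)
Lemma autocorr_not_derivable0 :
  ~ cvg ((autocorr h - autocorr (0 : R)) / h @[h --> 0^'+]).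
Proof.
move=> /cvg_ex[l /cvgrPdist_le/(_ 1 ltr01)].
rewrite autocorr0 => /nbhs_ballP[dl /= dl0 H].
pose M := `|l| + 1 + `|autocorr_cst| + 2.
have M0 : 0 < M by have := normr_ge0 l; have := normr_ge0 autocorr_cst; rewrite /M; lra.
pose h := Num.min (dl / 2) (expR (- (2 * (M + 1)))).
have h0 : 0 < h by rewrite lt_min divr_gt0 //= expR_gt0.
have hdl : h < dl by apply: (@le_lt_trans _ _ (dl / 2)); [rewrite ge_min lexx|lra].
have hM : h <= expR (- (2 * (M + 1))) by rewrite ge_min lexx orbT.
have hi : 0 < h^-1 by rewrite invr_gt0.
have lnh : 2 * (M + 1) <= ln h^-1.
  rewrite lnV ?posrE // lerNr -[leRHS]expRK ler_ln ?posrE // expR_gt0 //.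
have h1 : 1 <= h^-1.
  rewrite invf_ge1 //; apply: le_trans hM _.
  by rewrite -expR0 ler_expR oppr_le0 mulr_ge0 // addr_ge0 // ltW.
have := H h; rewrite /ball /= sub0r normrN gtr0_norm // => /(_ hdl h0).
rewrite subr0 autocorr_reciprocal // mulrC mulKf ?gt_eqF // => H1.
have := autocorr_ge_ln _ h1.
move: H1; rewrite ler_norml => /andP[H1 _].
have := ler_norm l; have := ler_norm (- autocorr_cst); rewrite normrN.
rewrite /M in lnh; lra.
Qed.

End Reciprocity.

(** * Continued fractions *)

Section Continuants.
Implicit Types (a : nat -> int) (u v : int).

(** The sequence [w 0 = v], [w (j + 1) = a j * w j + w (j - 1)] with
    [w (-1) = u].  Consuming [a] from the front matches the recursion of
    [cfrac]; [continuantSS] is the usual recurrence. *)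
Fixpoint continuant a u v (j : nat) : int :=
  if j is j'.+1 then continuant (fun i => a i.+1) v (a 0%N * v + u) j' else v.

Lemma continuantSS a u v j :
  continuant a u v j.+2 = a j.+1 * continuant a u v j.+1 + continuant a u v j.
Proof. by elim: j a u v => [//|j IH] a u v; rewrite [LHS]IH. Qed.

Lemma continuant_linear a u v j :
  continuant a u v j = u * continuant a 1 0 j + v * continuant a 0 1 j.
Proof.
elim: j a u v => [|j IH] a u v /=; first by rewrite mulr0 mulr1 add0r.
rewrite IH [in RHS]IH [X in _ + v * X]IH; ring.
Qed.

(** Numerators [p_(j-1)] and denominators [q_(j-1)] of the convergents,
    starting with [p_(-1) = 1] and [q_(-1) = 0]. *)
Definition cnum a := continuant a 0 1.
Definition cden a := continuant a 1 0.

Lemma cnumSS a j : cnum a j.+2 = a j.+1 * cnum a j.+1 + cnum a j.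
Proof. exact: continuantSS. Qed.

Lemma cdenSS a j : cden a j.+2 = a j.+1 * cden a j.+1 + cden a j.
Proof. exact: continuantSS. Qed.

Lemma cden_shift a j : cden a j.+1 = cnum (fun i => a i.+1) j.
Proof. by rewrite /cden /= mulr0 add0r. Qed.

Lemma cnum_shift a j :
  cnum a j.+1 = a 0%N * cnum (fun i => a i.+1) j + cden (fun i => a i.+1) j.
Proof. by rewrite /cnum /= mulr1 addr0 continuant_linear mul1r addrC. Qed.

(** This makes the fraction reduced, so that [denq] returns [cden]. *)
Lemma cdet a j : cden a j.+1 * cnum a j - cden a j * cnum a j.+1 = (-1) ^+ j.
Proof.
elim: j => [|j IH]; first by rewrite /cden /cnum /= expr0; ring.
rewrite exprS -IH cnumSS cdenSS; ring.
Qed.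

Lemma cden_ge a : (forall i, 1 <= a i.+1) ->
  forall j, 0 <= cden a j /\ (1 <= cden a j.+1 /\ cden a j <= cden a j.+1).
Proof.
move=> a1; elim=> [|j [h0 [h1 h2]]]; first by rewrite /cden /= mulr0 add0r.
rewrite cdenSS; have := a1 j; move: (a j.+1) h0 h1 h2 => c; nia.
Qed.

Lemma cfracE a k : (forall i, 1 <= a i.+1) ->
  cfrac a k = (cnum a k.+1)%:~R / (cden a k.+1)%:~R.
Proof.
elim: k a => [|k IH] a a1 /=.
  by rewrite /cnum /cden /= mulr1 addr0 mulr0 add0r divr1.
rewrite IH; last by move=> i; exact: a1.
rewrite invf_div [cnum a k.+2]cnum_shift [cden a k.+2]cden_shift.
have [_ [d1 _]] := cden_ge _ a1 k.+1.
have n0 : (cnum (fun i => a i.+1) k.+1)%:~R != 0 :> rat.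
  by rewrite intr_eq0 -cden_shift gt_eqF // (lt_le_trans ltr01).
by rewrite intrD intrM mulrDl mulfK.
Qed.

Lemma denq_cfrac a k : (forall i, 1 <= a i.+1) -> denq (cfrac a k) = cden a k.+1.
Proof.
move=> a1; rewrite cfracE //; have [_ [d1 _]] := cden_ge _ a1 k.
have d0 : 0 < cden a k.+1 by exact: lt_le_trans d1.
rewrite coprimeq_den.
  by rewrite gt_eqF // gtr0_norm.
apply/coprimezP; exists ((-1) ^+ k * - cden a k, (-1) ^+ k * cnum a k) => /=.
transitivity ((-1) ^+ k * (cden a k.+1 * cnum a k - cden a k * cnum a k.+1)); first by ring.
by rewrite cdet -expr2 sqrr_sign.
Qed.

End Continuants.

Section CompleteQuotients.
Context {R : realType}.
Implicit Types (x y t h : R).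

Lemma irrational_fracpart_gt0 y : irrational y -> 0 < fracpart y.
Proof.
move=> iy; rewrite lt_neqAle fracpart_ge0 andbT eq_sym; apply/eqP => y0; apply: iy.
apply/rationalP; exists (Num.floor y), 1%N.
by rewrite divr1; apply/eqP; rewrite -subr_eq0; apply/eqP.
Qed.

Lemma irrational_next y : irrational y -> irrational (fracpart y)^-1.
Proof.
move=> iy /= [q _ qE]; apply: iy; exists (q^-1 + (Num.floor y)%:~R) => //=.
by rewrite rmorphD fmorphV /= ratr_int qE invrK /fracpart subrK.
Qed.

(** The Gauss map orbit of [x]. *)
Definition cf_rem x j : R := fracpart (complete_quotient x j).

Variable x : R.
Hypothesis ix : irrational x.

Lemma cf_rem_bounds j : 0 < cf_rem x j < 1.
Proof.
have H k : irrational (complete_quotient x k).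
  by elim: k => [//|k IH]; exact: irrational_next.
by rewrite irrational_fracpart_gt0 //= fracpart_lt1.
Qed.

Lemma cf_remV j : (cf_rem x j)^-1 = (partial_quotient x j.+1)%:~R + cf_rem x j.+1.
Proof. by rewrite addrC /cf_rem [fracpart (complete_quotient x j.+1)]/fracpart subrK. Qed.

Lemma partial_quotient_ge1 j : 1 <= partial_quotient x j.+1.
Proof.
rewrite /partial_quotient /= floor_ge_int.
have /andP[h0 h1] := cf_rem_bounds j.
by rewrite (_ : 1%:~R = 1 :> R) // invf_ge1 //; exact: ltW.
Qed.

Let a := partial_quotient x.

(** The indices are shifted: this is [q_(j-1)], with [q_(-1) = 0]. *)
Definition cf_den (j : nat) : R := (cden a j)%:~R.

Lemma convergent_denE k : (convergent_den x k)%:~R = cf_den k.+1.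
Proof.
by rewrite /convergent_den /convergent denq_cfrac //; exact: partial_quotient_ge1.
Qed.

Lemma cf_den0 : cf_den 0 = 0. Proof. by []. Qed.

Lemma cf_denSS j : cf_den j.+2 = (a j.+1)%:~R * cf_den j.+1 + cf_den j.
Proof. by rewrite /cf_den cdenSS intrD intrM. Qed.

Lemma cf_den_ge0 j : 0 <= cf_den j.
Proof. by rewrite ler0z; have [] := cden_ge _ partial_quotient_ge1 j. Qed.

Lemma cf_denS_ge1 j : 1 <= cf_den j.+1.
Proof. by rewrite ler1z; have [_ []] := cden_ge _ partial_quotient_ge1 j. Qed.

Lemma cf_den_leS j : cf_den j <= cf_den j.+1.
Proof. by rewrite ler_int; have [_ []] := cden_ge _ partial_quotient_ge1 j. Qed.

Lemma cf_den_double j : 2 * cf_den j <= cf_den j.+2.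
Proof.
rewrite cf_denSS; have : 1 <= (a j.+1)%:~R :> R by rewrite ler1z partial_quotient_ge1.
have := cf_den_leS j; have := cf_denS_ge1 j; nra.
Qed.

(** Up to sign, [q_(j-1) t - p_(j-1)]: an affine function of [t], whose value
    at [x] is the product of the first [j] remainders. *)
Definition cf_lin (j : nat) t : R := (-1) ^+ j * ((cnum a j)%:~R - cf_den j * t).

Lemma cf_lin0 t : cf_lin 0 t = 1.
Proof. by rewrite /cf_lin /cf_den /cnum /cden /= expr0 mul1r mul0r subr0. Qed.

Lemma cf_lin1 t : cf_lin 1 t = t - (a 0%N)%:~R.
Proof.
rewrite /cf_lin /cf_den /cnum /cden /= expr1 mulr1 addr0 mulr0 add0r mul1r; ring.
Qed.

Lemma cf_linSS j t : cf_lin j.+2 t = cf_lin j t - (a j.+1)%:~R * cf_lin j.+1 t.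
Proof. by rewrite /cf_lin cf_denSS cnumSS intrD intrM !exprS; ring. Qed.

Lemma cf_lin_shift j t h : cf_lin j (t + h) = cf_lin j t - (-1) ^+ j * cf_den j * h.
Proof. by rewrite /cf_lin; ring. Qed.

(** As an identity in [t] it makes the derivative of the ratio of two
    consecutive forms an inverse square; at [x] it gives
    [cf_lin j x <= 1 / q_j]. *)
Lemma cf_wronskian j t : cf_den j.+1 * cf_lin j t + cf_den j * cf_lin j.+1 t = 1.
Proof.
elim: j => [|j IH]; first by rewrite cf_lin0 cf_den0 mul0r addr0 mulr1 /cf_den /cden /= mulr0 add0r.
rewrite cf_linSS cf_denSS -[RHS]IH; ring.
Qed.

Lemma cf_lin_rem j : 0 < cf_lin j x /\ cf_lin j.+1 x = cf_lin j x * cf_rem x j.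
Proof.
elim: j => [|j [h0 h1]]; first by rewrite cf_lin0 cf_lin1 mul1r.
have /andP[r0 _] := cf_rem_bounds j.
split; first by rewrite h1 mulr_gt0.
have rn := lt0r_neq0 r0.
rewrite cf_linSS; have -> : cf_rem x j.+1 = (cf_rem x j)^-1 - (a j.+1)%:~R.
  by rewrite cf_remV addrAC subrr add0r.
by rewrite h1; field.
Qed.

Lemma cf_lin_gt0 j : 0 < cf_lin j x.
Proof. by have [] := cf_lin_rem j. Qed.

Lemma cf_linS j : cf_lin j.+1 x = cf_lin j x * cf_rem x j.
Proof. by have [] := cf_lin_rem j. Qed.

Lemma cf_lin_leS j : cf_lin j.+1 x <= cf_lin j x.
Proof.
rewrite cf_linS ler_piMr ?(ltW (cf_lin_gt0 j)) //.
by have /andP[_ /ltW] := cf_rem_bounds j.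
Qed.

Lemma cf_lin_den j : cf_den j.+1 * cf_lin j x <= 1.
Proof.
rewrite -(cf_wronskian j x) lerDl mulr_ge0 ?cf_den_ge0 //.
exact: ltW (cf_lin_gt0 _).
Qed.

Lemma cf_lin_half j : cf_lin j.+2 x <= cf_lin j x / 2.
Proof.
have : 1 <= (a j.+1)%:~R :> R by rewrite ler1z partial_quotient_ge1.
have := cf_linSS j x; have := cf_lin_gt0 j.+1; have := cf_lin_gt0 j.+2.
have := cf_lin_leS j.+1; nra.
Qed.

End CompleteQuotients.

(** * Summability *)

Section Summability.
Context {R : realType}.

(** The sum is at most its first [m] terms plus half of itself. *)
Lemma halving_sum_bounded (u : nat -> R) m : (forall j, 0 <= u j) ->
  (forall j, u (j + m)%N <= u j / 2) ->
  exists B, forall n, \sum_(0 <= j < n) u j <= B.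
Proof.
move=> u0 um; exists (2 * \sum_(0 <= j < m) u j) => n.
have s0 k : 0 <= \sum_(0 <= j < k) u j by exact: sumr_ge0.
have : \sum_(0 <= j < n) u j <= \sum_(0 <= j < m) u j + \sum_(0 <= j < n) u j / 2.
  have -> : \sum_(0 <= j < m) u j + \sum_(0 <= j < n) u j / 2 =
      \sum_(0 <= j < m) u j + \sum_(0 <= j < n) u (j + m)%N +
      \sum_(0 <= j < n) (u j / 2 - u (j + m)%N) by rewrite sumrB; ring.
  rewrite -[X in X <= _]addr0; apply: lerD; last first.
    by apply: sumr_ge0 => j _; rewrite subr_ge0.
  have -> : \sum_(0 <= j < n) u (j + m)%N = \sum_(m <= j < m + n) u j.
    by rewrite -{2}[m]add0n big_addn addKn.
  rewrite -big_cat_nat //= ?leq_addr //.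
  rewrite addnC (@big_cat_nat _ _ _ n 0 (n + m)) //= ?leq_addr // lerDl.
  exact: sumr_ge0.
rewrite -mulr_suml; move: (\sum_(0 <= j < n) _) (\sum_(0 <= j < m) _) => s t; lra.
Qed.

Lemma bounded_sum_cvg (u : nat -> R) B : (forall j, 0 <= u j) ->
  (forall n, \sum_(0 <= j < n) u j <= B) -> cvgn (series u).
Proof.
move=> u0 uB; apply: nondecreasing_is_cvgn.
  by apply/nondecreasing_seqP => n; rewrite /series /= big_nat_recr //= lerDl.
by exists B => _ [n _ <-]; exact: uB.
Qed.

Lemma cvg_series_tail (u : nat -> R) e : (forall j, 0 <= u j) -> cvgn (series u) ->
  0 < e -> exists N, forall n, (N <= n)%N -> \sum_(N <= j < n) u j <= e.
Proof.
move=> u0 cu e0; have e2 : 0 < e / 2 by rewrite divr_gt0.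
have [N HN] := (cvgn_epsP _ _).1 cu (e / 2) e2; exists N => n Nn.
have := HN n Nn; have := HN N (leqnn N).
rewrite /series /= (@big_cat_nat _ _ _ N 0 n) //= !ler_norml => /andP[? ?] /andP[? ?].
lra.
Qed.

Lemma dominated_series_cvg (u v : nat -> R) c : cvgn (series u) ->
  (forall j, `|v j| <= c * u j) -> cvgn (series v).
Proof.
move=> cu vu; apply: normed_cvg.
apply: (@series_le_cvg _ _ (fun j => c * u j)) => //.
- by move=> n; exact: normr_ge0.
- by move=> n; apply: le_trans (normr_ge0 _) (vu n).
rewrite (_ : series _ = (fun n => c * series u n)).
  apply/cvg_ex; exists (c * limn (series u)).
  by apply: cvgM => //; exact: cvg_cst.
by apply/funext => n; rewrite /series /= -mulr_sumr.
Qed.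

End Summability.

(** * Difference quotients at an irrational point *)

Section Irrational.
Context {R : realType}.
Variable x : R.
Hypothesis ix : irrational x.
Implicit Types (t h e k : R).

(** The [j]-th term of the expansion of [bsum] at [x]. *)
Definition recip_term (j : nat) t : R :=
  cf_lin x j t ^+ 3 * recip_gap (cf_lin x j.+1 t / cf_lin x j t).

(** Iterating reciprocity along the continued fraction expansion of [x], for
    all [t] such that the affine forms of [x] are still positive at [t]. *)
Lemma bsum_expand t K : (forall j, (j <= K)%N -> 0 < cf_lin x j t) ->
  bsum t = \sum_(0 <= j < K) recip_term j t +
    cf_lin x K t ^+ 3 * bsum (cf_lin x K.+1 t / cf_lin x K t).
Proof.
elim: K => [_|K IH H].
  rewrite big_nil add0r cf_lin0 cf_lin1 divr1 expr1n mul1r -rmorphN /=.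
  by rewrite bsumD_int.
rewrite IH; last by move=> j jK; apply: H; rewrite leqW.
rewrite big_nat_recr //= -addrA; congr (_ + _).
have e0 := H K (leqnSn K); have e1 := H K.+1 (leqnn _).
have e0n := lt0r_neq0 e0; have e1n := lt0r_neq0 e1.
rewrite bsum_reciprocal; last by rewrite divr_gt0.
rewrite /recip_term invf_div mulrDr addrC; congr (_ + _).
rewrite mulrA -exprMn [X in X ^+ 3]mulrC divfK //; congr (_ * _).
rewrite cf_linSS mulrBl mulfK // -(bsumD_int (_ - _) (partial_quotient x K.+1)).
by rewrite subrK.
Qed.

(** The derivative of [recip_term], simplified by the Wronskian identity. *)
Definition recip_dterm (j : nat) t : R :=
  let s := cf_lin x j.+1 t / cf_lin x j t in
  - 3 * cf_lin x j t ^+ 2 * ((-1) ^+ j * cf_den x j) * recip_gap s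
  + (-1) ^+ j * cf_lin x j t * (ln s / 2 + recip_rest s).

Lemma der_cf_lin j t : is_derive t 1 (cf_lin x j) (- ((-1) ^+ j * cf_den x j)).
Proof.
apply: (@is_derive_near _ (fun z => (-1) ^+ j * (cnum (partial_quotient x) j)%:~R
  - (-1) ^+ j * cf_den x j * z) _ _ _ 1 ltr01).
  by move=> y _; rewrite /cf_lin; ring.
by apply: (is_derive_eq (derB (derC t _) (derZ _ (der_id t)))); rewrite sub0r mulr1.
Qed.

Lemma der_recip_term j t : 0 < cf_lin x j t -> 0 < cf_lin x j.+1 t ->
  is_derive t 1 (recip_term j) (recip_dterm j t).
Proof.
move=> e0 e1; have e0n := lt0r_neq0 e0.
have s0 : 0 < cf_lin x j.+1 t / cf_lin x j t by rewrite divr_gt0.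
have ds := derM (der_cf_lin j.+1 t) (derV e0n (der_cf_lin j t)).
apply: (is_derive_eq (derM (derX 3 (der_cf_lin j t))
  (der_comp (g := fun z => cf_lin x j.+1 z / cf_lin x j z) (der_recip_gap _ s0) ds))).
rewrite /recip_dterm; set s := _ / _.
have W := cf_wronskian x j t.
have -> : - ((-1) ^+ j.+1 * cf_den x j.+1) / cf_lin x j t + cf_lin x j.+1 t *
    (- - ((-1) ^+ j * cf_den x j) / cf_lin x j t ^+ 2) =
  (-1) ^+ j * (cf_den x j.+1 * cf_lin x j t + cf_den x j * cf_lin x j.+1 t)
    / cf_lin x j t ^+ 2 by rewrite exprS; field.
rewrite W; move: (recip_gap s) (recip_rest s) (ln s) => G r l.
by field.
Qed.

Lemma cf_lin_anti j K : (j <= K)%N -> cf_lin x K x <= cf_lin x j x.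
Proof.
elim: K => [|K IH]; first by rewrite leqn0 => /eqP->.
rewrite leq_eqVlt => /predU1P[->//|/IH h]; exact: le_trans (cf_lin_leS _ ix K) h.
Qed.

Lemma cf_den_mono j K : (j <= K)%N -> cf_den x j <= cf_den x K.
Proof.
elim: K => [|K IH]; first by rewrite leqn0 => /eqP->.
rewrite leq_eqVlt => /predU1P[->//|/IH] h; exact: le_trans h (cf_den_leS _ ix K).
Qed.

Lemma cf_den_lin j : cf_den x j * cf_lin x j x <= 1.
Proof.
apply: le_trans (cf_lin_den _ ix j); rewrite ler_pM2r ?cf_lin_gt0 //.
exact: cf_den_leS.
Qed.

Lemma cvg_cf_lin_series : cvgn (series (fun j => cf_lin x j x)).
Proof.
have u0 j : 0 <= cf_lin x j x by rewrite ltW // cf_lin_gt0.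
have [|B HB] := @halving_sum_bounded R (fun j => cf_lin x j x) 2 u0.
  by move=> j; rewrite addn2; exact: cf_lin_half.
exact: bounded_sum_cvg HB.
Qed.

Lemma cvg_cf_lin : (fun j => cf_lin x j x) @ \oo --> 0.
Proof. exact: cvg_series_cvg_0 cvg_cf_lin_series. Qed.

(** The step [h] moves none of the first [K] affine forms by more than half
    of its value. *)
Definition admissible (K : nat) h := cf_den x K * `|h| <= cf_lin x K x / 2.

Lemma admissible_le j K h : (j <= K)%N -> admissible K h -> admissible j h.
Proof.
move=> jK; rewrite /admissible => H; apply: le_trans (_ : cf_den x K * `|h| <= _).
  by rewrite ler_wpM2r // cf_den_mono.
apply: le_trans H _; rewrite ler_pM2r ?invr_gt0 //; exact: cf_lin_anti.
Qed.

Lemma admissible_norm K h h' : `|h'| <= `|h| -> admissible K h -> admissible K h'.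
Proof.
move=> hh; apply: le_trans; rewrite ler_wpM2l // cf_den_ge0 //.
Qed.

Lemma cf_lin_dist K h : `|cf_lin x K (x + h) - cf_lin x K x| = cf_den x K * `|h|.
Proof.
rewrite cf_lin_shift addrC addKr normrN !normrM normrX normrN1 expr1n mul1r.
by rewrite (ger0_norm (cf_den_ge0 _ ix K)).
Qed.

Lemma admissible_bounds K h : admissible K h ->
  cf_lin x K x / 2 <= cf_lin x K (x + h) <= 3 / 2 * cf_lin x K x.
Proof.
rewrite /admissible -cf_lin_dist ler_norml => /andP[? ?].
by apply/andP; split; lra.
Qed.

Lemma admissible_gt0 K h : admissible K h -> 0 < cf_lin x K (x + h).
Proof.
move=> /admissible_bounds/andP[+ _]; apply: lt_le_trans.
by rewrite divr_gt0 // cf_lin_gt0.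
Qed.

Lemma ln3_le2 : ln (3 : R) <= 2.
Proof. by have := @le_ln1Dx R 2; lra. Qed.

(** The logarithm of the ratio at [x] is unbounded in [j], but it is multiplied
    by the displacement of [cf_lin x j], at most half of [cf_lin x j.+1 x], and
    [a * ln a] is bounded. *)
Lemma recip_dterm_lip : exists2 C : R, 0 < C & forall j h, admissible j.+1 h ->
  `|recip_dterm j (x + h) - recip_dterm j x| <= C * cf_lin x j x.
Proof.
have [K K0 HK] := @recip_rest_bound R.
exists (275 + 3 * K) => [|j h adm]; first lra.
have adm0 := admissible_le _ _ _ (leqnSn j) adm.
have /andP[e1 e2] := admissible_bounds _ _ adm0.
have /andP[f1 f2] := admissible_bounds _ _ adm.
have de := cf_lin_dist j h.
have dh : cf_den x j * `|h| <= cf_lin x j x * cf_rem x j / 2.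
  rewrite -cf_linS //; apply: le_trans adm; rewrite ler_wpM2r //.
  exact: cf_den_leS.
have ep0 := cf_lin_gt0 _ ix j; have epS := cf_linS _ ix j.
have /andP[a0 a1] := cf_rem_bounds _ ix j.
have D0 := cf_den_ge0 _ ix j; have DE := cf_den_lin j.
have E0 : cf_lin x j.+1 x / cf_lin x j x = cf_rem x j.
  by rewrite epS mulrC mulKf // gt_eqF.
rewrite epS in f1 f2.
rewrite /recip_dterm E0.
set e := cf_lin x j x in e1 e2 f1 f2 de dh ep0 DE *.
set e' := cf_lin x j (x + h) in e1 e2 f1 f2 de *.
set f' := cf_lin x j.+1 (x + h) in f1 f2 *.
set a := cf_rem x j in f1 f2 a0 a1 dh *.
set d := cf_den x j in D0 DE de dh *.
clearbody e e' f' a d; clear E0 epS adm adm0.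
have e'0 : 0 < e' by apply: lt_le_trans e1; rewrite divr_gt0.
have f'0 : 0 < f' by apply: lt_le_trans f1; apply: divr_gt0 => //; exact: mulr_gt0.
have s1 : a / 3 <= f' / e' by rewrite ler_pdivlMr //; nra.
have s2 : f' / e' <= 3 * a by rewrite ler_pdivrMr //; nra.
set s := f' / e' in s1 s2 *.
have s0 : 0 < s by rewrite divr_gt0.
clearbody s; clear f1 f2 f'0 f'.
have G1 : `|recip_gap s| <= 28 by apply: recip_gap_bound; rewrite s0; lra.
have G2 : `|recip_gap a| <= 28 by apply: recip_gap_bound; rewrite a0; lra.
have r1 : `|recip_rest s| <= K by apply: HK; rewrite s0; lra.
have r2 : `|recip_rest a| <= K by apply: HK; rewrite a0; lra.
have l1 : `|ln s - ln a| <= 2.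
  have h3 := ln3_le2.
  have a3 : 0 < 3 * a by lra.
  have s3 : 0 < 3 * s by lra.
  have : ln s <= ln (3 * a) by rewrite ler_ln ?posrE.
  have : ln a <= ln (3 * s) by rewrite ler_ln ?posrE //; lra.
  have E3 (z : R) : 0 < z -> ln (3 * z) = ln 3 + ln z.
    by move=> z0; rewrite lnM ?posrE.
  rewrite (E3 _ a0) (E3 _ s0) => ? ?; rewrite ler_norml; apply/andP; split; lra.
have l2 : `|a * ln a| <= 1.
  have := xlnx_ge _ a0; have : a * ln a <= 0.
    by rewrite mulr_ge0_le0 ?(ltW a0) // ln_le0 // ltW.
  by move=> ? ?; rewrite ler_norml; apply/andP; split; lra.
set sg : R := (-1) ^+ j.
have sg1 : `|sg| = 1 by rewrite /sg normrX normrN1 expr1n.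
clearbody sg; clear HK.
have -> : - 3 * e' ^+ 2 * (sg * d) * recip_gap s + sg * e' * (ln s / 2 + recip_rest s)
   - (- 3 * e ^+ 2 * (sg * d) * recip_gap a + sg * e * (ln a / 2 + recip_rest a)) =
   sg * (- 3 * e' ^+ 2 * d * recip_gap s + 3 * e ^+ 2 * d * recip_gap a
    + (e' * recip_rest s - e * recip_rest a)
    + (e' * (ln s - ln a) / 2 + (e' - e) * ln a / 2)) by ring.
rewrite normrM sg1 mul1r.
have de0 : 0 <= d * e by rewrite mulr_ge0 // ltW.
(* The bounds [e' <= 3 / 2 * e], [d * e <= 1] and [28] for [recip_gap] give
   [189 = 3 * (9 / 4) * 28] and [84 = 3 * 28]. *)
have n3 : `|3 : R| = 3 by rewrite ger0_norm.
have t1 : `|- 3 * e' ^+ 2 * d * recip_gap s| <= 189 * e.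
  rewrite 3!normrM normrN (ger0_norm D0) n3 (ger0_norm (exprn_ge0 2 (ltW e'0))).
  have : e' ^+ 2 <= 9 / 4 * e ^+ 2 by nra.
  move=> q; have : e' ^+ 2 * d <= 9 / 4 * e * (d * e) by nra.
  move=> q'; have : e' ^+ 2 * d <= 9 / 4 * e by nra.
  have : 0 <= e' ^+ 2 * d by rewrite mulr_ge0 // exprn_ge0 // ltW.
  rewrite -[3 * _ * d]mulrA; move: (e' ^+ 2 * d) => w w0 w1.
  have : w * `|recip_gap s| <= w * 28 by rewrite ler_wpM2l.
  rewrite -mulrA; move: (w * _) => wg; clear -w1. lra.
have t2 : `|3 * e ^+ 2 * d * recip_gap a| <= 84 * e.
  rewrite 3!normrM (ger0_norm D0) n3 (ger0_norm (exprn_ge0 2 (ltW ep0))).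
  have : e ^+ 2 * d <= e by nra.
  have : 0 <= e ^+ 2 * d by rewrite mulr_ge0 // exprn_ge0 // ltW.
  rewrite -[3 * _ * d]mulrA; move: (e ^+ 2 * d) => w w0 w1.
  have : w * `|recip_gap a| <= w * 28 by rewrite ler_wpM2l.
  rewrite -mulrA; move: (w * _) => wg; clear -w1; lra.
have t3 : `|e' * recip_rest s| <= 3 / 2 * (K * e).
  rewrite normrM (gtr0_norm e'0).
  move: `|recip_rest s| r1 (normr_ge0 (recip_rest s)) => g; nra.
have t4 : `|e * recip_rest a| <= K * e.
  by rewrite normrM (gtr0_norm ep0) mulrC ler_pM2r.
have t5 : `|e' * (ln s - ln a) / 2| <= 3 / 2 * e.
  rewrite !normrM (gtr0_norm e'0) (gtr0_norm (_ : 0 < 2^-1)) ?invr_gt0 //.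
  move: `|ln s - ln a| l1 (normr_ge0 (ln s - ln a)) => g; nra.
have t6 : `|(e' - e) * ln a / 2| <= e / 4.
  rewrite !normrM de (gtr0_norm (_ : 0 < 2^-1)) ?invr_gt0 //.
  move: l2; rewrite normrM (gtr0_norm a0); move: `|ln a| (normr_ge0 (ln a)) => l l0 l2.
  have : d * `|h| * l <= e * a / 2 * l by rewrite ler_wpM2r.
  nra.
move: t1 t2 t3 t4 t5 t6.
move: (- 3 * _ * _ * _) (3 * _ * _ * _) (e' * recip_rest s) (e * recip_rest a).
move: (e' * _ / 2) ((e' - e) * _ / 2) => v1 v2 v3 v4 v5 v6.
have Ke : 0 <= K * e by rewrite mulr_ge0 // ltW.
have -> : (275 + 3 * K) * e = 275 * e + 3 * (K * e) by ring.
move: (K * e) Ke => w Ke.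
clear - Ke ep0; rewrite !ler_norml.
move=> /andP[? ?] /andP[? ?] /andP[? ?] /andP[? ?] /andP[? ?] /andP[? ?].
by apply/andP; split; lra.
Qed.

End Irrational.

Section IrrationalQuotients.
Context {R : realType}.
Variable x : R.
Hypothesis ix : irrational x.
Implicit Types (t h e k : R).

Lemma cf_ratio j : cf_lin x j.+1 x / cf_lin x j x = cf_rem x j.
Proof. by rewrite (cf_linS _ ix) mulrC mulKf // gt_eqF // cf_lin_gt0. Qed.

Lemma continuous_recip_dterm j : {for x, continuous (recip_dterm x j)}.
Proof.
have c i : {for x, continuous (cf_lin x i)} := is_derive_continuous _ _ _ (der_cf_lin x i x).
have e0 := lt0r_neq0 (cf_lin_gt0 _ ix j).
have /andP[a0 _] := cf_rem_bounds _ ix j; rewrite -cf_ratio in a0.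
have cs : {for x, continuous (fun t => cf_lin x j.+1 t / cf_lin x j t)}.
  by apply: cvgM; [exact: c|apply: cvgV => //; exact: c].
apply: cvgD; apply: cvgM.
- apply: cvgM; last exact: cvg_cst.
  apply: cvgM; first exact: cvg_cst.
  by apply: (@continuous_comp _ _ _ (cf_lin x j) (fun z => z ^+ 2)) => //; exact: exprn_continuous.
- apply: (@continuous_comp _ _ _ _ recip_gap x cs).
  exact: is_derive_continuous (der_recip_gap _ a0).
- by apply: cvgM; [exact: cvg_cst|exact: c].
- apply: cvgD.
    apply: cvgM; last exact: cvg_cst.
    by apply: (@continuous_comp _ _ _ _ (@ln R) x cs); exact: continuous_ln.
  by apply: (@continuous_comp _ _ _ _ recip_rest x cs); exact: continuous_recip_rest.
Qed.

Lemma recip_dterm_main : exists2 C : R, 0 < C & forall j,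
  `|recip_dterm x j x - (-1) ^+ j * cf_lin x j x * ln (cf_rem x j) / 2| <= C * cf_lin x j x.
Proof.
have [K K0 HK] := @recip_rest_bound R.
exists (84 + K) => [|j]; first lra.
rewrite /recip_dterm cf_ratio.
have /andP[a0 a1] := cf_rem_bounds _ ix j.
have ep0 := cf_lin_gt0 _ ix j; have D0 := cf_den_ge0 _ ix j; have DE := cf_den_lin _ ix j.
have G : `|recip_gap (cf_rem x j)| <= 28 by apply: recip_gap_bound; rewrite a0; lra.
have r : `|recip_rest (cf_rem x j)| <= K by apply: HK; rewrite a0; lra.
set sg : R := (-1) ^+ j.
have sg1 : `|sg| = 1 by rewrite /sg normrX normrN1 expr1n.
move: (cf_lin x j x) (cf_den x j) (recip_gap _) (recip_rest _) ep0 D0 DE G r => e d g r ep0 D0 DE G1 r1.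
clearbody sg.
have -> : - 3 * e ^+ 2 * (sg * d) * g + sg * e * (ln (cf_rem x j) / 2 + r)
  - sg * e * ln (cf_rem x j) / 2 = sg * (e * (r - 3 * (d * e) * g)) by ring.
rewrite normrM sg1 mul1r normrM (gtr0_norm ep0) mulrC ler_pM2r //.
have de0 : 0 <= d * e by rewrite mulr_ge0 // ltW.
apply: le_trans (ler_normB _ _) _; rewrite [84 + K]addrC; apply: lerD => //.
rewrite normrM ger0_norm; last by rewrite mulr_ge0.
have : 3 * (d * e) * `|g| <= 3 * 1 * 28 by apply: ler_pM; rewrite ?mulr_ge0 //; lra.
by move/le_trans; apply; lra.
Qed.

(** Only finitely many terms matter, uniformly in the number [K] of steps: the
    others are dominated by the summable sequence [cf_lin x j x]. *)
Lemma recip_dterm_tannery e : 0 < e -> exists2 dl, 0 < dl &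
  forall (K : nat) h (xi : nat -> R), `|h| < dl -> admissible x K h ->
    (forall j, `|xi j - x| <= `|h|) ->
    `|\sum_(0 <= j < K) recip_dterm x j (xi j) - \sum_(0 <= j < K) recip_dterm x j x| <= e.
Proof.
move=> e0; have [C C0 HC] := recip_dterm_lip _ ix.
have u0 j : 0 <= cf_lin x j x by rewrite ltW // cf_lin_gt0.
have e2C : 0 < e / 2 / C by rewrite !divr_gt0.
have [N HN] := cvg_series_tail _ _ u0 (cvg_cf_lin_series _ ix) e2C.
have fin M r : 0 < r -> exists2 dl, 0 < dl & forall xi : nat -> R,
    (forall j, `|xi j - x| < dl) ->
    \sum_(0 <= j < M) `|recip_dterm x j (xi j) - recip_dterm x j x| <= r.
  elim: M r => [|M IH] r r0.
    by exists 1 => // xi _; rewrite big_nil ltW.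
  have r2 : 0 < r / 2 by rewrite divr_gt0.
  have [d1 d10 H1] := IH _ r2.
  have [d2 d20 H2] := (continuous_epsP _ _).1 (continuous_recip_dterm M) _ r2.
  exists (Num.min d1 d2); first by rewrite lt_min d10.
  move=> xi Hxi; rewrite big_nat_recr //= [leRHS](splitr r); apply: lerD.
    by apply: H1 => j; have := Hxi j; rewrite lt_min => /andP[].
  by apply: H2; have := Hxi M; rewrite lt_min => /andP[].
have [dl dl0 Hdl] := fin N (e / 2) (divr_gt0 e0 (ltr0Sn _ 1)).
exists dl => // K h xi hdl adm Hxi.
have H1 := Hdl xi (fun j => le_lt_trans (Hxi j) hdl).
rewrite -sumrB; apply: le_trans (ler_norm_sum _ _ _) _.
have [KN|NK] := leqP K N.
  apply: (@le_trans _ _ (e / 2)); last by lra.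
  apply: le_trans H1; rewrite (@big_cat_nat _ _ _ K 0 N) //= lerDl.
  exact: sumr_ge0.
rewrite (@big_cat_nat _ _ _ N 0 K) //=; last exact: ltnW.
rewrite [leRHS](splitr e); apply: lerD => //.
have -> : e / 2 = C * (e / 2 / C) by field; exact: lt0r_neq0.
apply: (@le_trans _ _ (C * \sum_(N <= j < K) cf_lin x j x)); last first.
  by rewrite ler_pM2l // HN // ltnW.
rewrite mulr_sumr !big_nat; apply: ler_sum => j /andP[_ jK].
have -> : xi j = x + (xi j - x) by rewrite addrC subrK.
apply: HC; apply: (admissible_norm _ ix _ h) => //.
exact: admissible_le adm.
Qed.

(** The rest of the expansion after [K] steps is controlled by the logarithmic
    modulus of continuity of [bsum], since the last ratio moves by about
    [h / cf_lin x K x ^+ 2]. *)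
Lemma remainder_bound K h k : admissible x K h -> 0 < k <= 1 ->
  k * cf_lin x K x ^+ 2 <= 2 / 3 * `|h| ->
  `|cf_lin x K (x + h) ^+ 3 * bsum (cf_lin x K.+1 (x + h) / cf_lin x K (x + h))
    - cf_lin x K x ^+ 3 * bsum (cf_lin x K.+1 x / cf_lin x K x)| <=
  `|h| * (cf_lin x K x * (11 - 2 * ln k)).
Proof.
move=> adm k01 kh; have /andP[k0 k1] := k01.
have /andP[e1 e2] := admissible_bounds _ ix _ _ adm.
have de := cf_lin_dist _ ix K h.
have ep0 := cf_lin_gt0 _ ix K; have e'0 := admissible_gt0 _ ix _ _ adm.
have DE := cf_den_lin _ ix K.
have dist : `|cf_lin x K.+1 (x + h) / cf_lin x K (x + h) - cf_lin x K.+1 x / cf_lin x K x|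
    = `|h| / (cf_lin x K x * cf_lin x K (x + h)).
  have W := cf_wronskian x K x.
  have -> : cf_lin x K.+1 (x + h) / cf_lin x K (x + h) - cf_lin x K.+1 x / cf_lin x K x =
      (-1) ^+ K * h * (cf_den x K.+1 * cf_lin x K x + cf_den x K * cf_lin x K.+1 x)
      / (cf_lin x K x * cf_lin x K (x + h)).
    have E1 := cf_lin_shift x K x h; have E2 := cf_lin_shift x K.+1 x h.
    have n1 := lt0r_neq0 ep0; have n2 := lt0r_neq0 e'0.
    move: (cf_lin x K (x + h)) E1 n2 => e' E1 n2.
    rewrite E2 exprS.
    transitivity (((cf_lin x K.+1 x + (-1) ^+ K * cf_den x K.+1 * h) * cf_lin x K x
      - cf_lin x K.+1 x * e') / (cf_lin x K x * e')); first by field; rewrite n1 n2.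
    by congr (_ / _); rewrite E1; ring.
  rewrite W mulr1 normrM normrM normrX normrN1 expr1n mul1r normfV.
  by rewrite (gtr0_norm (mulr_gt0 ep0 e'0)).
set s' := cf_lin x K.+1 (x + h) / _ in dist *; set s := cf_lin x K.+1 x / _ in dist *.
move: (cf_lin x K (x + h)) (cf_lin x K x) (cf_den x K) dist e1 e2 de ep0 e'0 DE kh.
move=> e' e d dist e1 e2 de ep0 e'0 DE kh; clear adm; clearbody s s'.
have lk : ln k <= 0 by exact: ln_le0.
have h0 := normr_ge0 h.
have kd : k <= `|s' - s|.
  rewrite dist ler_pdivlMr ?mulr_gt0 //.
  have : k * e * e' <= k * e * (3 / 2 * e) by rewrite ler_pM2l ?mulr_gt0.
  have -> : k * e * (3 / 2 * e) = 3 / 2 * (k * e ^+ 2) by ring.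
  rewrite -mulrA; move: (k * e ^+ 2) kh => w ? ?; lra.
have M := bsum_log_modulus _ _ _ k01 kd.
have dist2 : e ^+ 3 * `|s' - s| <= 2 * `|h| * e.
  rewrite dist mulrA ler_pdivrMr ?mulr_gt0 //.
  have : `|h| * e ^+ 2 * e <= `|h| * e ^+ 2 * (2 * e').
    by rewrite ler_wpM2l ?mulr_ge0 ?sqr_ge0 //; lra.
  by congr (_ <= _); ring.
have -> : e' ^+ 3 * bsum s' - e ^+ 3 * bsum s =
  (e' - e) * (e' ^+ 2 + e' * e + e ^+ 2) * bsum s' + e ^+ 3 * (bsum s' - bsum s) by ring.
apply: le_trans (ler_normD _ _) _.
have -> : `|h| * (e * (11 - 2 * ln k)) = 5 * `|h| * e + 2 * `|h| * e * (3 - ln k) by ring.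
apply: lerD; last first.
  rewrite normrM (gtr0_norm (exprn_gt0 3 ep0)).
  have : e ^+ 3 * `|bsum s' - bsum s| <= e ^+ 3 * (`|s' - s| * (3 - ln k)).
    by rewrite ler_pM2l // exprn_gt0.
  move/le_trans; apply; rewrite mulrA; apply: ler_wpM2r => //; lra.
have q0 : 0 <= e' ^+ 2 + e' * e + e ^+ 2 by rewrite !addr_ge0 ?sqr_ge0 // mulr_ge0 // ltW.
rewrite !normrM de (ger0_norm q0).
have q1 : e' ^+ 2 + e' * e + e ^+ 2 <= 5 * e ^+ 2 by nra.
have q2 : d * `|h| * (e' ^+ 2 + e' * e + e ^+ 2) <= d * `|h| * (5 * e ^+ 2).
  by apply: ler_wpM2l => //; rewrite -de.
have q3 : d * `|h| * (5 * e ^+ 2) <= 5 * `|h| * e.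
  have -> : d * `|h| * (5 * e ^+ 2) = 5 * `|h| * e * (d * e) by ring.
  by rewrite ler_piMr // !mulr_ge0 // ltW.
apply: le_trans (le_trans q2 q3); rewrite ler_piMr //; last exact: bsum_norm.
by rewrite mulr_ge0 // -de.
Qed.

(** The mean value theorem is applied to each term of the expansion; the
    points it provides depend on [j], which dominated convergence allows. *)
Lemma bsum_quotient e : 0 < e -> exists2 dl, 0 < dl &
  forall (K : nat) h k, `|h| < dl -> admissible x K h -> 0 < k <= 1 ->
    k * cf_lin x K x ^+ 2 <= 2 / 3 * `|h| ->
    `|bsum (x + h) - bsum x - h * \sum_(0 <= j < K) recip_dterm x j x| <=
      `|h| * (e + cf_lin x K x * (11 - 2 * ln k)).
Proof.
move=> e0; have [dl dl0 Hdl] := recip_dterm_tannery _ e0.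
exists dl => // K h k hdl adm k01 kh.
have rb := remainder_bound _ _ _ adm k01 kh.
have pos j h' : (j <= K)%N -> `|h'| <= `|h| -> 0 < cf_lin x j (x + h').
  move=> jK hh; apply: admissible_gt0 => //; apply: admissible_norm hh _ => //.
  exact: admissible_le jK adm.
have /choice[xi Hxi] : forall j, exists t, `|t - x| <= `|h| /\
    ((j < K)%N -> recip_term x j (x + h) - recip_term x j x = recip_dterm x j t * h).
  move=> j.
  have [jK|Kj] := ltnP j K; last by exists x; rewrite subrr normr0.
  have near c : x <= c <= x + h \/ x + h <= c <= x -> `|c - x| <= `|h|.
    by case=> /andP[? ?]; [rewrite !ger0_norm; lra|rewrite !ler0_norm; lra].
  have [|c [hc E]] := @mvt_between R (recip_term x j) (recip_dterm x j) x (x + h).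
    move=> c /near hc; have -> : c = x + (c - x) by rewrite addrC subrK.
    by apply: der_recip_term; apply: pos => //; exact: ltnW.
  by exists c; split; [exact: near|rewrite E addrAC subrr add0r].
have E1 := bsum_expand x (x + h) K (fun j jK => pos j h jK (lexx _)).
have E2 := bsum_expand x x K (fun j _ => cf_lin_gt0 _ ix j).
have T := Hdl K h xi hdl adm (fun j => proj1 (Hxi j)).
have E3 : \sum_(0 <= j < K) recip_term x j (x + h) - \sum_(0 <= j < K) recip_term x j x =
    (\sum_(0 <= j < K) recip_dterm x j (xi j)) * h.
  rewrite -sumrB mulr_suml !big_nat; apply: eq_bigr => j /andP[_ jK].
  exact: (proj2 (Hxi j)).
rewrite E1 E2 mulrDr.
set r1 := cf_lin x K (x + h) ^+ 3 * _ in rb *; set r2 := cf_lin x K x ^+ 3 * _ in rb *.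
have -> : \sum_(0 <= j < K) recip_term x j (x + h) + r1 -
    (\sum_(0 <= j < K) recip_term x j x + r2) - h * \sum_(0 <= j < K) recip_dterm x j x =
  h * (\sum_(0 <= j < K) recip_dterm x j (xi j) - \sum_(0 <= j < K) recip_dterm x j x)
    + (r1 - r2).
  move: E3; move: (\sum_(0 <= j < K) recip_term x j (x + h)) => S E.
  have -> : S = \sum_(0 <= j < K) recip_term x j x + (S - \sum_(0 <= j < K) recip_term x j x) by ring.
  by rewrite E; ring.
apply: le_trans (ler_normD _ _) _; apply: lerD => //.
by rewrite normrM ler_wpM2l.
Qed.

(** The step [cf_lin x K x ^+ 2 / 2] moves the [K]-th ratio by a
    quantity of order [1], so that the remainder is [O(cf_lin x K x)]. *)
Lemma derivable_bsum_cvg : derivable (@bsum R) x 1 ->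
  cvgn (series (fun j => recip_dterm x j x)).
Proof.
move=> /derivableE[d /is_derive_epsP Hd]; apply/cvg_ex; exists d.
apply/cvgn_epsP => e e0; have e4 : 0 < e / 4 by rewrite divr_gt0.
have [d1 d10 H1] := Hd _ e4; have [d2 d20 H2] := bsum_quotient _ e4.
have m0 : 0 < Num.min (Num.min d1 d2) (Num.min 1 (e / 64)).
  by rewrite !lt_min d10 d20 ltr01 divr_gt0.
have [N HN] := (cvgn_epsP _ _).1 (cvg_cf_lin _ ix) _ m0.
exists N => K NK; have := HN K NK; rewrite subr0 => /(le_trans (ler_norm _)).
rewrite !le_min => /andP[/andP[u1 u2] /andP[u3 u4]].
have ep0 := cf_lin_gt0 _ ix K.
pose h := cf_lin x K x ^+ 2 / 2.
have h0 : 0 < h by rewrite divr_gt0 // exprn_gt0.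
have hep : h < cf_lin x K x by rewrite /h; nra.
have adm : admissible x K h.
  rewrite /admissible (gtr0_norm h0) /h.
  have -> : cf_den x K * (cf_lin x K x ^+ 2 / 2) =
    cf_den x K * cf_lin x K x * (cf_lin x K x / 2) by ring.
  by rewrite ler_piMl ?cf_den_lin // divr_ge0 // ltW.
have := H2 K h 3^-1; rewrite (gtr0_norm h0) => /(_ (lt_le_trans hep u2) adm).
have k01 : 0 < (3^-1 : R) <= 1 by apply/andP; split; lra.
have kh : 3^-1 * cf_lin x K x ^+ 2 <= 2 / 3 * h by rewrite /h; lra.
move=> /(_ k01 kh) B1.
have := H1 h; rewrite (gtr0_norm h0) => /(_ (lt_le_trans hep u1)) B2.
have l3 : cf_lin x K x * (11 - 2 * ln 3^-1) <= e / 4.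
  rewrite lnV ?posrE //; have := ln3_le2 (R := R); have := @ln_ge0 R 3; nra.
have B3 : `|h * (series (fun j => recip_dterm x j x) K - d)| <= h * e.
  have -> : h * (series (fun j => recip_dterm x j x) K - d) =
    (bsum (x + h) - bsum x - d * h)
    - (bsum (x + h) - bsum x - h * \sum_(0 <= j < K) recip_dterm x j x).
    by rewrite /series /=; ring.
  apply: le_trans (ler_normB _ _) _; apply: le_trans (lerD B2 B1) _.
  rewrite [e / 4 * h]mulrC -mulrDr ler_pM2l //; lra.
by move: B3; rewrite normrM (gtr0_norm h0) ler_pM2l.
Qed.

(** The last admissible [K] makes [h] at least a multiple of
    [cf_rem x K * cf_lin x K x ^+ 2], hence a remainder bounded by
    [cf_lin x K x * ln (1 / cf_rem x K)], essentially a term of the series. *)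
Lemma cvg_derivable_bsum : cvgn (series (fun j => recip_dterm x j x)) ->
  derivable (@bsum R) x 1.
Proof.
move=> cS; have cT := cvg_series_cvg_0 cS.
set S := limn (series (fun j => recip_dterm x j x)).
apply/derivableE; exists S; apply/is_derive_epsP => e e0.
have e4 : 0 < e / 4 by rewrite divr_gt0.
have [d1 d10 H1] := bsum_quotient _ e4.
have [C C0 HC] := recip_dterm_main.
have [N1 HN1] := (cvgn_epsP _ _).1 cS _ e4.
have e32 : 0 < e / 32 by rewrite divr_gt0.
have [N2 HN2] := (cvgn_epsP _ _).1 cT _ e32.
have m0 : 0 < Num.min (e / 120) (e / 32 / C) by rewrite lt_min !divr_gt0.
have [N3 HN3] := (cvgn_epsP _ _).1 (cvg_cf_lin _ ix) _ m0.
pose K0 := maxn N1 (maxn N2 N3).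
have small K : (K0 <= K)%N -> cf_lin x K x * (11 - 2 * ln (cf_rem x K / 3)) <= e / 2.
  rewrite /K0 !geq_max => /and3P[_ n2 n3].
  have := HN2 K n2; rewrite subr0 => b2.
  have := HN3 K n3; rewrite subr0 => /(le_trans (ler_norm _)).
  rewrite le_min => /andP[b3 b4]; rewrite ler_pdivlMr // in b4.
  have ep0 := cf_lin_gt0 _ ix K; have /andP[a0 a1] := cf_rem_bounds _ ix K.
  have := HC K.
  set w := recip_dterm x K x in b2 *.
  have E : `|(-1) ^+ K * cf_lin x K x * ln (cf_rem x K) / 2| =
      cf_lin x K x * - ln (cf_rem x K) / 2.
    rewrite 3!normrM normrX normrN1 expr1n mul1r (gtr0_norm ep0).
    by rewrite (gtr0_norm (_ : 0 < 2^-1)) ?invr_gt0 // ler0_norm // ln_le0 // ltW.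
  move=> b1; have : cf_lin x K x * - ln (cf_rem x K) / 2 <= e / 32 + e / 32.
    rewrite -E; set z := (-1) ^+ K * _ * _ / 2 in b1 *.
    have -> : z = w - (w - z) by ring.
    apply: le_trans (ler_normB _ _) _; apply: lerD => //.
    by apply: le_trans b1 _; rewrite mulrC.
  rewrite ln_div ?posrE // => b5.
  have l3 := ln3_le2 (R := R).
  have : cf_lin x K x * ln 3 <= cf_lin x K x * 2 by rewrite ler_pM2l.
  move: b5 b3; rewrite mulrN.
  rewrite (_ : cf_lin x K x * (11 - 2 * (ln (cf_rem x K) - ln 3)) =
     11 * cf_lin x K x - 2 * (cf_lin x K x * ln (cf_rem x K)) + 2 * (cf_lin x K x * ln 3)); last by ring.
  move: (cf_lin x K x * ln (cf_rem x K)) (cf_lin x K x * ln 3) (cf_lin x K x) => p q r.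
  clear -e0; lra.
have D0 : 0 < cf_lin x K0 x / 2 / (cf_den x K0 + 1).
  rewrite !divr_gt0 ?cf_lin_gt0 // ltr_wpDl // cf_den_ge0 //.
exists (Num.min d1 (cf_lin x K0 x / 2 / (cf_den x K0 + 1))); first by rewrite lt_min d10.
move=> h; rewrite lt_min => /andP[hd1 hd2].
have [->|h0] := eqVneq h 0; first by rewrite mulr0 normr0 mulr0 addr0 !subrr normr0.
have nh0 : 0 < `|h| by rewrite normr_gt0.
have adm0 : admissible x K0 h.
  move: hd2; rewrite ltr_pdivlMr ?ltr_wpDl ?cf_den_ge0 // /admissible => /ltW.
  by apply: le_trans; rewrite mulrC ler_pM2l // lerDl.
have [N HN] := (cvgn_epsP _ _).1 (cvg_cf_lin _ ix) _ nh0.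
(* The forms at [x] tend to [0] while the denominators are at least [1], so a
   nonzero [h] is not admissible for all [K]. *)
have ex : exists K, (K0 <= K)%N && ~~ `[< admissible x K.+1 h >].
  exists (maxn K0 N); rewrite leq_maxl /=; apply/asboolPn; rewrite /admissible.
  have := HN (maxn K0 N).+1 (leqW (leq_maxr _ _)); rewrite subr0 => /(le_trans (ler_norm _)).
  have := cf_denS_ge1 _ ix (maxn K0 N); have := cf_lin_gt0 _ ix (maxn K0 N).+1.
  move: (cf_lin x _ x) (cf_den x _) => u v u0 v1 uh vh.
  have : 1 * `|h| <= v * `|h| by rewrite ler_pM2r.
  lra.
case: (ex_minnP ex) => K /andP[K0K /asboolPn nadm] Kmin.
have adm : admissible x K h.
  case: (ltnP K0 K) => [lt|le]; last by rewrite (_ : K = K0) //; apply/eqP; rewrite eqn_leq le.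
  have KS : K = K.-1.+1 by rewrite prednK // (leq_ltn_trans _ lt).
  rewrite KS; apply: contrapT => nadm'.
  have /Kmin : (K0 <= K.-1)%N && ~~ `[< admissible x K.-1.+1 h >].
    by apply/andP; split; [rewrite -ltnS -KS|apply/asboolPn].
  by rewrite {1}KS ltnn.
have ep0 := cf_lin_gt0 _ ix K; have /andP[a0 a1] := cf_rem_bounds _ ix K.
have kh : cf_rem x K / 3 * cf_lin x K x ^+ 2 <= 2 / 3 * `|h|.
  have : cf_lin x K.+1 x / 2 < cf_den x K.+1 * `|h| by rewrite ltNge; apply/negP.
  rewrite (cf_linS _ ix) => lt.
  have : cf_lin x K x * (cf_lin x K x * cf_rem x K / 2) <=
      cf_lin x K x * (cf_den x K.+1 * `|h|) by rewrite ler_pM2l // ltW.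
  have : cf_den x K.+1 * cf_lin x K x * `|h| <= 1 * `|h|.
    by rewrite ler_pM2r // cf_lin_den.
  rewrite [cf_lin x K x * (cf_den _ _ * _)]mulrA [cf_lin x K x * cf_den _ _]mulrC.
  rewrite (_ : cf_rem x K / 3 * _ = 2 / 3 * (cf_lin x K x * (cf_lin x K x * cf_rem x K / 2))); last by field.
  rewrite mul1r; move: (cf_den x K.+1 * cf_lin x K x * `|h|) (cf_lin x K x * (_ * _ / 2)).
  by clear => p q; lra.
have k01 : 0 < cf_rem x K / 3 <= 1 by apply/andP; split; lra.
have B1 := H1 K h _ hd1 adm k01 kh.
have B2 := small K K0K.
have B3 := HN1 K (leq_trans (leq_maxl _ _) K0K).
have -> : bsum (x + h) - bsum x - S * h =
    (bsum (x + h) - bsum x - h * \sum_(0 <= j < K) recip_dterm x j x)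
    + h * (series (fun j => recip_dterm x j x) K - S) by rewrite /series /=; ring.
apply: le_trans (ler_normD _ _) _; rewrite normrM.
have : `|h| * `|series (fun j => recip_dterm x j x) K - S| <= `|h| * (e / 4) by rewrite ler_wpM2l.
have : `|h| * (e / 4 + cf_lin x K x * (11 - 2 * ln (cf_rem x K / 3))) <= `|h| * (e / 4 + e / 2).
  by rewrite ler_wpM2l // lerD2l.
rewrite [e * `|h|]mulrC; move: B1.
have -> : `|h| * e = `|h| * (e / 4 + e / 2) + `|h| * (e / 4) by field.
move=> /le_trans h1 /h1 {h1} h1 h2; exact: lerD.
Qed.

End IrrationalQuotients.

(** * Comparison with the series over the denominators *)

Section Comparison.
Context {R : realType}.
Variable x : R.
Hypothesis ix : irrational x.

(** The inverse of [cf_rem x j] and the ratio of the two denominators lie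
    between the same two consecutive integers, so their logarithms differ by at
    most [ln 2]; and [cf_lin x j x] differs from the inverse of the denominator
    by at most [cf_rem x j] times it, which absorbs the logarithm. *)
Lemma log_den_close j :
  `|cf_lin x j x * ln (cf_rem x j) + ln (cf_den x j.+2) / cf_den x j.+1| <=
  (2 + ln (cf_den x j.+1)) / cf_den x j.+1.
Proof.
have /andP[a0 a1] := cf_rem_bounds _ ix j.
have /andP[b0 b1] := cf_rem_bounds _ ix j.+1.
have aV := cf_remV x j; have A1 := partial_quotient_ge1 _ ix j.
have {A1} : 1 <= (partial_quotient x j.+1)%:~R :> R by rewrite ler1z.
have d1 := cf_denS_ge1 _ ix j; have d'0 := cf_den_ge0 _ ix j.
have d'd := cf_den_leS _ ix j; have W := cf_wronskian x j x.
have ep0 := cf_lin_gt0 _ ix j.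
rewrite (cf_linS _ ix) in W; rewrite cf_denSS in aV *.
move: (cf_lin x j x) (cf_rem x j) (cf_rem x j.+1) (cf_den x j.+1) (cf_den x j)
  ((partial_quotient x j.+1)%:~R) a0 a1 b0 b1 aV d1 d'0 d'd W ep0.
move=> e a b d d' A a0 a1 b0 b1 aV d1 d'0 d'd W ep0 A1.
have d0 : 0 < d by lra.
have aA : a * (A + b) = 1 by rewrite -aV mulfV // gt_eqF.
have N0 : 0 < A * d + d' by rewrite ltr_wpDr // mulr_gt0 //; lra.
have xl := xlnx_ge _ a0.
have al : a * ln a <= 0 by rewrite mulr_ge0_le0 ?(ltW a0) // ln_le0 // ltW.
have l2 := @ln2_le1 R.
have u1 : ln (A * d + d') + ln a <= ln d + 1.
  have : ln ((A * d + d') * a) <= ln (2 * d).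
    rewrite ler_ln ?posrE ?mulr_gt0 //.
    have Aa : A * a <= 1 by nra.
    have : A * d * a <= d by rewrite mulrAC ler_piMl // ltW.
    have : d' * a <= d' by rewrite ler_piMr // ltW.
    rewrite mulrDl; lra.
  rewrite (@lnM _ (A * d + d') a) ?posrE // (@lnM _ 2 d) ?posrE //; lra.
have u2 : ln d - 1 <= ln (A * d + d') + ln a.
  have : ln d <= ln (2 * ((A * d + d') * a)).
    rewrite ler_ln ?posrE ?mulr_gt0 //.
    have Aa : 1 <= 2 * (A * a) by nra.
    have : 1 * d <= 2 * (A * a) * d by rewrite ler_pM2r.
    have : 0 <= d' * a by rewrite mulr_ge0 // ltW.
    have -> : 2 * ((A * d + d') * a) = 2 * (A * a) * d + 2 * (d' * a) by ring.
    move: (2 * (A * a) * d) (d' * a) => p q; lra.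
  rewrite (@lnM _ 2 (_ * _)) ?posrE ?mulr_gt0 // (@lnM _ (A * d + d') a) ?posrE //; lra.
have ed : e * d = 1 - d' * e * a by rewrite -W; ring.
have q : d' * e <= 1.
  have : d' * e <= d * e by rewrite ler_pM2r.
  have : 0 <= d' * e * a by rewrite !mulr_ge0 // ltW.
  lra.
have E : e * ln a + ln (A * d + d') / d =
    (ln (A * d + d') + ln a - d' * e * (a * ln a)) / d.
  transitivity ((e * d * ln a + ln (A * d + d')) / d); first by field; exact: lt0r_neq0.
  by rewrite ed; congr (_ / _); ring.
have q0 : 0 <= d' * e by rewrite mulr_ge0 // ltW.
have : -1 <= d' * e * (a * ln a) <= 0.
  by rewrite mulr_ge0_le0 // andbT; move: (d' * e) (a * ln a) q q0 xl al => ? ? ? ? ? ?; nra.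
move=> /andP[v1 v2].
have ld : 0 <= ln d by exact: ln_ge0.
rewrite E normrM normfV (gtr0_norm d0) ler_pM2r ?invr_gt0 // ler_norml.
set p := d' * e * (a * ln a) in v1 v2 *; clearbody p; clear - v1 v2 u1 u2 ld.
by apply/andP; split; lra.
Qed.

(** The denominators at least double every two steps. *)
Lemma inv_sqrt_den_halving j :
  (Num.sqrt (cf_den x (j + 4).+1))^-1 <= (Num.sqrt (cf_den x j.+1))^-1 / 2.
Proof.
have h1 := cf_den_double _ ix j.+1; have h2 := cf_den_double _ ix j.+3.
have d1 := cf_denS_ge1 _ ix j.
have s0 : 0 < Num.sqrt (cf_den x j.+1) by rewrite sqrtr_gt0; lra.
have H : 2 * Num.sqrt (cf_den x j.+1) <= Num.sqrt (cf_den x j.+4.+1).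
  rewrite -[leLHS]ger0_norm; last by rewrite mulr_ge0 // ltW.
  rewrite -sqrtr_sqr ler_sqrt; last by lra.
  by rewrite exprMn sqr_sqrtr; lra.
rewrite -invfM addn4 lef_pV2 ?posrE.
- by rewrite mulrC.
- by apply: lt_le_trans H; rewrite mulr_gt0.
- by rewrite mulr_gt0.
Qed.

Lemma log_over_den_le (d : R) : 1 <= d -> (2 + ln d) / d <= 4 / Num.sqrt d.
Proof.
move=> d1; have d0 : 0 < d by lra.
set s := Num.sqrt d; have ss : s ^+ 2 = d by rewrite sqr_sqrtr // ltW.
have s0 : 0 < s by rewrite sqrtr_gt0.
have s1 : 1 <= s by nra.
have := ln_sublinear s0; rewrite -ss lnXn // mulr2n => l.
rewrite ler_pdivrMr ?exprn_gt0 //.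
have -> : 4 / s * s ^+ 2 = 4 * s by field; exact: lt0r_neq0.
lra.
Qed.

(** A term of the differentiated expansion is, up to the factor [- 1 / 2] and
    a summable error, the corresponding term of the series. *)
Lemma cvg_recip_dterm_series :
  cvgn (series (fun j => recip_dterm x j x)) <->
  cvgn (series (fun j => (-1) ^+ j * ln (cf_den x j.+2) / cf_den x j.+1)).
Proof.
set w := fun j => (-1) ^+ j * ln (cf_den x j.+2) / cf_den x j.+1.
have [C C0 HC] := recip_dterm_main _ ix.
pose v j := recip_dterm x j x + w j / 2.
pose u j := cf_lin x j x + (Num.sqrt (cf_den x j.+1))^-1.
have cu : cvgn (series u).
  have c1 := cvg_cf_lin_series _ ix.
  have s0 j : 0 <= (Num.sqrt (cf_den x j.+1))^-1 by rewrite invr_ge0 sqrtr_ge0.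
  have [B HB] := @halving_sum_bounded R _ 4 s0 inv_sqrt_den_halving.
  have c2 := bounded_sum_cvg _ _ s0 HB.
  rewrite (_ : series u = series (fun j => cf_lin x j x) \+
      series (fun j => (Num.sqrt (cf_den x j.+1))^-1)); first exact: is_cvgD.
  by apply/funext => n; rewrite /series /= -big_split.
have cv : cvgn (series v).
  apply: (@dominated_series_cvg _ u _ (C + 4) cu) => j.
  have sg1 : `|(-1) ^+ j : R| = 1 by rewrite normrX normrN1 expr1n.
  have -> : v j = (recip_dterm x j x - (-1) ^+ j * cf_lin x j x * ln (cf_rem x j) / 2)
      + (-1) ^+ j * ((cf_lin x j x * ln (cf_rem x j)
        + ln (cf_den x j.+2) / cf_den x j.+1) / 2) by rewrite /v /w; ring.
  apply: le_trans (ler_normD _ _) _.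
  rewrite [X in _ + X]normrM sg1 mul1r normrM.
  have := HC j; have := log_den_close j.
  have := log_over_den_le _ (cf_denS_ge1 _ ix j).
  rewrite (gtr0_norm (_ : 0 < 2^-1)) ?invr_gt0 // /u.
  have ep0 := cf_lin_gt0 _ ix j.
  have s0 : 0 <= (Num.sqrt (cf_den x j.+1))^-1 by rewrite invr_ge0 sqrtr_ge0.
  move: `|_ + _| `|_ - _| ((_ + _) / _) => p q r.
  move: (Num.sqrt _)^-1 (cf_lin x j x) s0 ep0 => s e s0 ep0.
  clear -C0 s0 ep0; nra.
split=> c.
  rewrite (_ : series w = (fun n => 2 * (series v n - series (fun j => recip_dterm x j x) n))).
    apply/cvg_ex; eexists; apply: cvgM; first exact: cvg_cst.
    exact: cvgB cv c.
  apply/funext => n; rewrite /series /= -sumrB mulr_sumr; apply: eq_bigr => i _.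
  by rewrite /v; field.
rewrite (_ : series _ = (fun n => series v n - 2^-1 * series w n)).
  apply/cvg_ex; eexists; apply: (cvgB cv); apply: cvgM; first exact: cvg_cst.
  exact: c.
apply/funext => n; rewrite /series /= mulr_sumr -sumrB; apply: eq_bigr => i _.
by rewrite /v; field.
Qed.

End Comparison.

(** * The points of differentiability *)

Theorem mainTheorem1 (R : realType) (lambda : R) (hlambda : 0 <= lambda) :
  differentiable_on_halfline (@autocorr R) lambda <->
  [/\ 0 < lambda,
      irrational lambda
    & cvgn (series (fun k : nat =>
        (-1) ^+ k * ln ((convergent_den lambda k.+1)%:~R : R)
          / (convergent_den lambda k)%:~R))].
Proof.
have E : irrational lambda -> series (fun k : nat =>
    (-1) ^+ k * ln ((convergent_den lambda k.+1)%:~R : R) / (convergent_den lambda k)%:~R) =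
  series (fun j => (-1) ^+ j * ln (cf_den lambda j.+2) / cf_den lambda j.+1).
  by move=> il; congr series; apply/funext => k; rewrite !convergent_denE.
split.
  case=> [[l0 /(derivable_autocorr _ l0) D]|[-> /autocorr_not_derivable0//]].
  have il : irrational lambda.
    move=> /rationalP[p [q lE]]; rewrite lE in l0 D.
    have q0 : (0 < q)%N.
      by case: q l0 {lE D} => // /[!(invr0, mulr0)]; rewrite ltxx.
    exact: bsum_not_derivable_rational q0 D.
  have c := derivable_bsum_cvg _ il D.
  by split; [exact: l0|exact: il|rewrite (E il); exact: (proj1 (cvg_recip_dterm_series _ il) c)].
case=> l0 il; rewrite (E il) => c.
left; split; first exact: l0.
apply: (proj2 (derivable_autocorr _ l0)).
exact: cvg_derivable_bsum il (proj2 (cvg_recip_dterm_series _ il) c).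
Qed.
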